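(* Let $d\ge 2$ and $n\ge 3$ be integers. Consider $n$ hard balls in $\mathbb{R}^d$ (with no walls: the billiard table is all of $\mathbb{R}^d$) with identical masses and identical radii, moving on the time interval $(-\infty,\infty)$ and colliding totally elastically, with no simultaneous collisions. Then the total number of collisions between the balls during $(-\infty,\infty)$ is bounded above by $$1600\,\left(1000\cdot 32^{5^d}\right)^n\, n^{\left(\frac32\cdot 5^d+\frac92\right)n+\frac32}.$$
   Context: Let $r>0$ be the common radius of the balls. All balls have the same mass. For $k=1,\dots,n$, the center of the $k$-th ball at time $t\in\mathbb{R}$ is $x^k(t)\in\mathbb{R}^d$, a continuous function of $t$, and its velocity is $v^k(t)$, so that $x^k$ is piecewise linear with derivative $v^k$ away from collision times. The balls are hard, i.e. $|x^j(t)-x^k(t)|\ge 2r$ for all $j\ne k$ and all $t$. The $j$-th and $k$-th balls ($j\neq k$) are said to collide at time $t$ if $|x^j(t)-x^k(t)|=2r$ and their velocities change at time $t$. Velocities are constant between collision times, and the velocity of a ball changes only at a time when this ball takes part in a collision. Collision times have no accumulation points, so the one-sided limits $v^k(t-)$ and $v^k(t+)$ exist for all $t$. Elastic collision rule (equal masses): if the $j$-th and $k$-th balls collide at time $t$, then the velocities just before the collision satisfy $$(v^j(t-)-v^k(t-))\cdot(x^j(t)-x^k(t))<0,$$ and, with $x^{jk}(t)=(x^j(t)-x^k(t))/|x^j(t)-x^k(t)|$, the velocities just after the collision are $$v^j(t+)=v^j(t-)+(v^k(t-)\cdot x^{jk}(t))\,x^{jk}(t)-(v^j(t-)\cdot x^{jk}(t))\,x^{jk}(t),$$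 $$v^k(t+)=v^k(t-)+(v^j(t-)\cdot x^{jk}(t))\,x^{jk}(t)-(v^k(t-)\cdot x^{jk}(t))\,x^{jk}(t).$$ That is, the two balls exchange the components of their velocities parallel to the line through their centers, and the orthogonal components are unchanged; the velocities of all other balls are unchanged at time $t$. No simultaneous collisions means that at each time $t$ at most one pair of balls collides. The number of collisions is the number of pairs $(t,\{j,k\})$ such that the $j$-th and $k$-th balls collide at time $t$. *)

(* Defs.v *)
From mathcomp Require Import all_boot all_order all_algebra finmap.
From mathcomp Require Import all_classical all_reals all_analysis.

Set Implicit Arguments.
Unset Strict Implicit.
Unset Printing Implicit Defensive.

Import Order.TTheory GRing.Theory Num.Theory.
Import numFieldNormedType.Exports.

Local Open Scope classical_set_scope.
Local Open Scope ring_scope.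

(* The library norm `|u| on 'rV[R]_d is the sup norm, so the Euclidean
   structure is introduced here; both induce the same topology. *)
Definition dotp (R : realType) (d : nat) (u w : 'rV[R]_d) : R :=
  \sum_(i < d) u ord0 i * w ord0 i.

Definition enorm (R : realType) (d : nat) (u : 'rV[R]_d) : R :=
  Num.sqrt (dotp u u).

(* One-sided limits w(t-) and w(t+). [lim] is meaningful for the velocities of
   a [hard_ball_motion]: they are locally constant on both sides of any time. *)
Definition limL (R : realType) (d : nat) (w : R -> 'rV[R]_d) (t : R) :
  'rV[R]_d := lim (w s @[s --> t^'-]).

Definition limR (R : realType) (d : nat) (w : R -> 'rV[R]_d) (t : R) :
  'rV[R]_d := lim (w s @[s --> t^'+]).

Section Motion.
Context (R : realType) (d n : nat) (r : R).
Context (x v : 'I_n -> R -> 'rV[R]_d).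

Definition collide (j k : 'I_n) (t : R) : Prop :=
  [/\ j != k, enorm (x j t - x k t) = 2 * r,
      limL (v j) t <> limR (v j) t & limL (v k) t <> limR (v k) t].

Definition collision_times : set R :=
  [set t | exists j k, collide j k t].

Definition collisions : set (R * {set 'I_n}) :=
  [set p | exists j k, collide j k p.1 /\ p.2 = [set j; k]%SET].

Definition direction (j k : 'I_n) (t : R) : 'rV[R]_d :=
  (enorm (x j t - x k t))^-1 *: (x j t - x k t).

Definition elastic_collision (j k : 'I_n) (t : R) : Prop :=
  let e := direction j k t in
  [/\ dotp (limL (v j) t - limL (v k) t) (x j t - x k t) < 0,
      limR (v j) t = limL (v j) t + dotp (limL (v k) t) e *: e
                                  - dotp (limL (v j) t) e *: e &
      limR (v k) t = limL (v k) t + dotp (limL (v j) t) e *: e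
                                  - dotp (limL (v k) t) e *: e].

(* The values of the velocities at the collision times themselves are left
   unconstrained: only their one-sided limits are used there. *)
Record hard_ball_motion : Prop := HardBallMotion {
  hbm_continuous : forall k, continuous (x k);
  hbm_hard : forall j k t, j != k -> 2 * r <= enorm (x j t - x k t);
  hbm_discrete : limit_point collision_times = set0;
  hbm_derive : forall k t,
    ~ collision_times t -> is_derive t (1 : R) (x k) (v k t);
  hbm_constant : forall k a b,
    (forall t, a < t < b -> ~ collision_times t) ->
    forall s t, a < s < b -> a < t < b -> v k s = v k t;
  hbm_unchanged : forall k t,
    ~ (exists j, collide j k t) -> limL (v k) t = limR (v k) t;
  hbm_elastic : forall j k t, collide j k t -> elastic_collision j k t
}.

Definition no_simultaneous_collisions : Prop :=
  forall t j k j' k', collide j k t -> collide j' k' t ->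
    [set j; k]%SET = [set j'; k']%SET.

End Motion.

(* Main.v *)
Require Import Defs.
From mathcomp Require Import all_boot all_order all_algebra finmap.
From mathcomp Require Import all_classical all_reals all_analysis.
From mathcomp Require Import zify ring lra.

(** A run of consecutive collisions is a polygonal path of constant speed in
    the configuration space.  The pair of balls colliding at a vertex is an
    obstacle: the convex set of the configurations in which the two centres are
    at distance at most 2r.  At a vertex the velocity jumps along the outward
    normal of that obstacle.  This and the convexity of the obstacles are all
    that is used of the elastic law in the counting.

    If p lies in all obstacles, the jumps push away from p.  So the angle between
    the velocity and the direction from p only decreases, and a flight decreases
    it by the angle that it subtends at p.  A stretch of the path that meets
    every obstacle while this angle hardly changes stays, up to scaling towards
    p, near one point, which is therefore near all the obstacles (lemma cone).

    Local bound.  Suppose that a point at distance at most e from each of N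
    obstacles is at distance at most A e from a common point.  By induction on N,
    a long run can be cut into many stretches that meet all the obstacles.  The
    distance f of the path to the common points is convex in time.  If p and q
    are common points near two points of the path, some flight between them has
    nearly the velocity of the segment from p to q (slow_flight).  After it the
    angle seen from p is small, of the order of f divided by the elapsed time,
    and each later stretch consumes a fixed multiple of 1/A of it.  The same
    holds before it, seen from q.  Around the minimum of f, and where f has
    doubled, this leaves O(A) stretches (total_count), so that there are at most
    c^N collisions with c = O(A) (local_count).

    For balls, shrinking each cluster shows that A = 2 n sqrt n is admissible
    (contact_retract), and packing shows that a ball has fewer than 5^d balls
    within distance 4r (packing), so that at most n 5^d / 2 pairs can meet while
    the configuration moves by r.

    Global bound.  Let the rank of a run be n minus the number of connected
    components of its graph of colliding pairs.  By induction on the rank, a long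
    run is cut into stretches with the same components as the whole run.  In the
    frame of the centroids of the components the origin is a common point.  Where
    the configuration is far from the origin compared with r, each stretch
    consumes a fixed part of the angle, so that there are O(n^2) such stretches;
    where it is near, the elapsed length is O(n^2 r) and the local bound applies
    to pieces of length r (apex_total, global_count).  There are at most n
    inductive steps, each costing a factor O(n^2). *)

Set Implicit Arguments.
Unset Strict Implicit.
Unset Printing Implicit Defensive.

Import Order.TTheory GRing.Theory Num.Theory.

Local Open Scope ring_scope.

(** * Euclidean geometry *)

(* The hypotheses on reals are dropped first because they slow lia down. *)
Ltac nlia := repeat match goal with
  | H : is_true (@Order.le _ _ _ _) |- _ => clear H
  | H : is_true (@Order.lt _ _ _ _) |- _ => clear H
  | H : is_true (_ && _) |- _ => case/andP: H => ? ?
  | H : forall _, _ |- _ => clear H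
  end; lia.

Section Euclid.
Context {R : realType} {m : nat}.
Implicit Types (u w z : 'rV[R]_m) (c : R).

Lemma dotpC u w : dotp u w = dotp w u.
Proof. by apply: eq_bigr => i _; rewrite mulrC. Qed.

Lemma dotpDl u w z : dotp (u + w) z = dotp u z + dotp w z.
Proof. by rewrite -big_split; apply: eq_bigr => i _; rewrite mxE mulrDl. Qed.

Lemma dotpZl c u w : dotp (c *: u) w = c * dotp u w.
Proof. by rewrite /dotp mulr_sumr; apply: eq_bigr => i _; rewrite mxE mulrA. Qed.

Lemma dotpNl u w : dotp (- u) w = - dotp u w.
Proof. by rewrite -scaleN1r dotpZl mulN1r. Qed.

Lemma dotpBl u w z : dotp (u - w) z = dotp u z - dotp w z.
Proof. by rewrite dotpDl dotpNl. Qed.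

Lemma dotpDr u w z : dotp z (u + w) = dotp z u + dotp z w.
Proof. by rewrite !(dotpC z) dotpDl. Qed.

Lemma dotpZr c u w : dotp w (c *: u) = c * dotp w u.
Proof. by rewrite !(dotpC w) dotpZl. Qed.

Lemma dotpNr u w : dotp w (- u) = - dotp w u.
Proof. by rewrite !(dotpC w) dotpNl. Qed.

Lemma dotpBr u w z : dotp z (u - w) = dotp z u - dotp z w.
Proof. by rewrite dotpDr dotpNr. Qed.

Lemma dotp0l u : dotp 0 u = 0.
Proof. by rewrite -(scale0r 0) dotpZl mul0r. Qed.

Lemma dotp0r u : dotp u 0 = 0.
Proof. by rewrite dotpC dotp0l. Qed.

Definition dotpE := (dotpDl, dotpDr, dotpBl, dotpBr, dotpNl, dotpNr,
  dotpZl, dotpZr, dotp0l, dotp0r).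

Lemma dotp_ge0 u : 0 <= dotp u u.
Proof. by apply: sumr_ge0 => i _; rewrite -expr2 sqr_ge0. Qed.

Lemma dotp_eq0 u : dotp u u = 0 -> u = 0.
Proof.
move=> /eqP; rewrite psumr_eq0; last by move=> i _; rewrite -expr2 sqr_ge0.
move=> /allP h; apply/rowP => i; rewrite mxE.
by have := h i (mem_index_enum _); rewrite mulf_eq0 orbb => /eqP.
Qed.

Lemma enorm_ge0 u : 0 <= enorm u.
Proof. exact: sqrtr_ge0. Qed.

Lemma enorm_sqr u : enorm u ^+ 2 = dotp u u.
Proof. by rewrite sqr_sqrtr ?dotp_ge0. Qed.

Lemma enorm0 : enorm (0 : 'rV[R]_m) = 0.
Proof. by rewrite /enorm dotp0l sqrtr0. Qed.

Lemma enorm0_eq0 u : enorm u = 0 -> u = 0.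
Proof. by move=> h; apply: dotp_eq0; rewrite -enorm_sqr h expr0n. Qed.

Lemma le_enorm u c : 0 <= c -> dotp u u <= c ^+ 2 -> enorm u <= c.
Proof.
move=> c0; rewrite -enorm_sqr => h.
by rewrite -(@ler_pXn2r _ 2) // nnegrE ?enorm_ge0.
Qed.

Lemma ge_enorm u c : 0 <= c -> c ^+ 2 <= dotp u u -> c <= enorm u.
Proof.
move=> c0; rewrite -enorm_sqr => h.
by rewrite -(@ler_pXn2r _ 2) // nnegrE ?enorm_ge0.
Qed.

Lemma enormZ c u : enorm (c *: u) = `|c| * enorm u.
Proof.
by rewrite /enorm !dotpE mulrA -expr2 sqrtrM ?sqr_ge0 // sqrtr_sqr.
Qed.

Lemma enormN u : enorm (- u) = enorm u.
Proof. by rewrite /enorm !dotpE opprK. Qed.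

Lemma enormB u w : enorm (u - w) = enorm (w - u).
Proof. by rewrite -enormN opprB. Qed.

Lemma cauchy_schwarz u w : dotp u w <= enorm u * enorm w.
Proof.
have [w0|w0] := eqVneq (enorm w) 0.
  by rewrite (enorm0_eq0 w0) dotp0r enorm0 mulr0.
have wp : 0 < enorm w by rewrite lt_def w0 enorm_ge0.
have [h|h] := lerP (dotp u w) 0.
  by apply: (le_trans h); rewrite mulr_ge0 ?enorm_ge0.
rewrite -(@ler_pXn2r _ 2) ?nnegrE ?(ltW h) ?mulr_ge0 ?enorm_ge0 //.
have := dotp_ge0 (dotp w w *: u - dotp u w *: w).
rewrite !dotpE (dotpC w u) exprMn !enorm_sqr => h1.
have wp2 : 0 < dotp w w by rewrite -enorm_sqr exprn_gt0.
rewrite -subr_ge0 -(pmulr_rge0 _ wp2); apply: le_trans h1 _.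
by rewrite le_eqVlt; apply/orP; left; apply/eqP; ring.
Qed.

Lemma cauchy_schwarz_abs u w : `|dotp u w| <= enorm u * enorm w.
Proof.
rewrite ler_norml cauchy_schwarz andbT lerNl -dotpNl -(enormN u).
exact: cauchy_schwarz.
Qed.

Lemma enormD u w : enorm (u + w) <= enorm u + enorm w.
Proof.
apply: le_enorm; first by rewrite addr_ge0 ?enorm_ge0.
rewrite !dotpE (dotpC w u) sqrrD !enorm_sqr.
by have := cauchy_schwarz u w; lra.
Qed.

Lemma enorm_tri z u w : enorm (u - w) <= enorm (u - z) + enorm (z - w).
Proof. by apply: le_trans (enormD _ _); rewrite addrA subrK. Qed.

Lemma enorm_geB u w : enorm u - enorm w <= enorm (u - w).
Proof. by rewrite lerBlDr; apply: le_trans (enormD _ _); rewrite subrK. Qed.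

End Euclid.

(** * Billiard paths seen from a point of all obstacles *)

(** Vertex k is the collision number k of a run, tau its time and lab its pair of
    balls; W k is the velocity between the vertices k and k+1.  The jumps at the two
    end vertices are left free, so that sub-runs and reversed runs are again paths. *)
Record billiard (R : realType) (m : nat) (I : finType) (B : I -> set 'rV[R]_m)
    (S : {set I}) (K : nat) (tau : nat -> R) (X W : nat -> 'rV[R]_m)
    (lab : nat -> I) : Prop := Billiard {
  bp_lab : forall k, (k <= K)%N -> lab k \in S;
  bp_hit : forall k, (k <= K)%N -> B (lab k) (X k);
  bp_time : forall k, (k < K)%N -> tau k < tau k.+1;
  bp_move : forall k, (k < K)%N ->
    X k.+1 = X k + (tau k.+1 - tau k) *: W k;
  bp_unit : forall k, (k < K)%N -> dotp (W k) (W k) = 1;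
  bp_jump : forall k y, (k.+1 < K)%N -> B (lab k.+1) y ->
    dotp (W k.+1 - W k) (y - X k.+1) <= 0;
  bp_turn : forall k, (k.+1 < K)%N -> W k.+1 <> W k }.

Definition core (R : realType) (m : nat) (I : finType)
  (B : I -> set 'rV[R]_m) (S : {set I}) : set 'rV[R]_m :=
  [set p | forall i, i \in S -> B i p]%classic.

Section Basic.
Context {R : realType} {m : nat} {I : finType}.
Context (B : I -> set 'rV[R]_m).

Lemma billiard_sub (S S' : {set I}) K tau X W lab i K' :
  billiard B S K tau X W lab -> (i + K' <= K)%N ->
  (forall k, (k <= K')%N -> lab (i + k)%N \in S') ->
  billiard B S' K' (fun k => tau (i + k)%N) (fun k => X (i + k)%N)
    (fun k => W (i + k)%N) (fun k => lab (i + k)%N).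
Proof.
move=> [hl hh ht hm hu hj hn] hK hS'; split => //=.
- by move=> k hk; apply: hh; lia.
- by move=> k hk; rewrite addnS; apply: ht; lia.
- by move=> k hk; rewrite addnS; apply: hm; lia.
- by move=> k hk; apply: hu; lia.
- by move=> k y hk; rewrite addnS; apply: hj; lia.
- by move=> k hk; rewrite addnS; apply: hn; lia.
Qed.

(** Reflection is reversible; this turns each count of later collisions into one
    of earlier collisions. *)
Lemma billiard_rev (S : {set I}) K tau X W lab :
  billiard B S K tau X W lab ->
  billiard B S K (fun k => - tau (K - k)%N) (fun k => X (K - k)%N)
    (fun k => - W (K - k.+1)%N) (fun k => lab (K - k)%N).
Proof.
move=> [hl hh ht hm hu hj hn]; split => /=.
- by move=> k hk; apply: hl; lia.
- by move=> k hk; apply: hh; lia.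
- move=> k hk; have := ht (K - k.+1)%N ltac:(lia).
  by rewrite ltrN2; have -> : (K - k.+1).+1 = (K - k)%N by lia.
- move=> k hk; have := hm (K - k.+1)%N ltac:(lia).
  have -> : (K - k.+1).+1 = (K - k)%N by lia.
  by move=> ->; rewrite opprK [- tau _ + _]addrC scalerN addrK.
- by move=> k hk; rewrite !dotpE opprK hu //; lia.
- move=> k y hk hB; have := hj (K - k.+2)%N y ltac:(lia).
  have -> : (K - k.+2).+1 = (K - k.+1)%N by lia.
  by move=> /(_ hB); rewrite opprK [- W _ + _]addrC.
- move=> k hk; have := hn (K - k.+2)%N ltac:(lia).
  have -> : (K - k.+2).+1 = (K - k.+1)%N by lia.
  by move=> h /oppr_inj h'; apply: h.
Qed.

End Basic.

Section Radial.
Context {R : realType} {m : nat} {I : finType}.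
Context {B : I -> set 'rV[R]_m} {S : {set I}} {K : nat}.
Context {tau : nat -> R} {X W : nat -> 'rV[R]_m} {lab : nat -> I}.
Hypothesis hp : billiard B S K tau X W lab.

Lemma tau_mono i j : (i <= j <= K)%N -> tau i <= tau j.
Proof.
move=> /andP[ij]; elim: j ij => [|j IH].
  by rewrite leqn0 => /eqP ->.
rewrite leq_eqVlt => /orP[/eqP -> //|ij jK].
by apply: le_trans (IH ij (ltnW jK)) (ltW (bp_time hp jK)).
Qed.

Lemma tau_lt i j : (i < j <= K)%N -> tau i < tau j.
Proof.
move=> h; apply: lt_le_trans (bp_time hp (k := i) _) _; first by lia.
by apply: tau_mono; lia.
Qed.

Lemma unit_enorm k : (k < K)%N -> enorm (W k) = 1.
Proof. by move=> hk; rewrite /enorm (bp_unit hp) // sqrtr1. Qed.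

Lemma X_lip i j : (i <= j <= K)%N -> enorm (X j - X i) <= tau j - tau i.
Proof.
move=> /andP[ij]; elim: j ij => [|j IH].
  by rewrite leqn0 => /eqP ->; rewrite !subrr enorm0.
rewrite leq_eqVlt => /orP[/eqP -> |ij jK]; first by rewrite !subrr enorm0.
apply: le_trans (enorm_tri (X j) _ _) _.
have -> : tau j.+1 - tau i = (tau j.+1 - tau j) + (tau j - tau i) by ring.
apply: lerD; last by apply: IH; lia.
rewrite (bp_move hp) // addrAC subrr add0r enormZ unit_enorm // mulr1.
by rewrite ger0_norm // subr_ge0 ltW // (bp_time hp).
Qed.

Section Center.
Context {p : 'rV[R]_m}.
Hypothesis pcore : core B S p.

(** With p at the origin, the derivative of half the squared distance to p. *)
Definition radial k := dotp (X k - p) (W k).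
(** The impact parameter: the distance from p to the line of the flight k. *)
Definition impact k := enorm (X k - p - radial k *: W k).

Lemma radial_flight k : (k < K)%N ->
  dotp (X k.+1 - p) (W k) = radial k + (tau k.+1 - tau k).
Proof.
move=> hk; rewrite (bp_move hp) // (addrAC (X k)) dotpDl dotpZl (bp_unit hp) //.
by rewrite mulr1.
Qed.

Lemma impact_flight k : (k < K)%N ->
  X k.+1 - p - (radial k + (tau k.+1 - tau k)) *: W k = X k - p - radial k *: W k.
Proof.
move=> hk; rewrite {1}(bp_move hp) // (scalerDl _ (radial k)) (addrAC (X k)).
by rewrite [radial k *: _ + _]addrC opprD addrA addrK.
Qed.

(** The jump at a vertex is along an outward normal of an obstacle that contains
    p, so it cannot decrease the radial speed. *)
Lemma radial_step k : (k.+1 < K)%N -> radial k + (tau k.+1 - tau k) <= radial k.+1.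
Proof.
move=> hk; rewrite -radial_flight; last by lia.
have := bp_jump hp hk (pcore (bp_lab hp (ltnW hk))).
rewrite -oppr_ge0 -dotpNr opprB dotpBl (dotpC (W k.+1)) (dotpC (W k)) /radial.
by rewrite subr_ge0.
Qed.

Lemma radial_mono i j : (i <= j < K)%N -> radial i + (tau j - tau i) <= radial j.
Proof.
move=> /andP[ij]; elim: j ij => [|j IH].
  by rewrite leqn0 => /eqP ->; rewrite subrr addr0.
rewrite leq_eqVlt => /orP[/eqP -> |ij jK]; first by rewrite subrr addr0.
apply: le_trans (radial_step jK); have := IH ij (ltnW jK); lra.
Qed.

Lemma radial_le k : (k < K)%N -> radial k <= enorm (X k - p).
Proof.
by move=> hk; apply: le_trans (cauchy_schwarz _ _) _; rewrite unit_enorm // mulr1.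
Qed.

Lemma radial_ge k : (k < K)%N -> - enorm (X k - p) <= radial k.
Proof.
move=> hk; have := cauchy_schwarz_abs (X k - p) (W k).
by rewrite unit_enorm // mulr1 ler_norml => /andP[].
Qed.

Lemma impact_ge0 k : 0 <= impact k. Proof. exact: enorm_ge0. Qed.

Lemma impact_sqr k : (k < K)%N -> impact k ^+ 2 = dotp (X k - p) (X k - p) - radial k ^+ 2.
Proof.
move=> hk; rewrite enorm_sqr; set D := X k - p.
rewrite (_ : radial k = dotp D (W k)) // !(dotpBl _ (_ *: _)) !(dotpBr _ (_ *: _)).
by rewrite !dotpZl !dotpZr (bp_unit hp) // (dotpC (W k) D); ring.
Qed.

Lemma impact_min k s : (k < K)%N -> impact k <= enorm (X k - p - s *: W k).
Proof.
move=> hk; apply: ge_enorm; first exact: impact_ge0.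
rewrite impact_sqr //; set D := X k - p.
rewrite (_ : radial k = dotp D (W k)) // !(dotpBl _ (_ *: _)) !(dotpBr _ (_ *: _)).
rewrite !dotpZl !dotpZr (bp_unit hp) // (dotpC (W k) D).
have := sqr_ge0 (s - dotp D (W k)); lra.
Qed.

Lemma impact_le k : (k < K)%N -> impact k <= enorm (X k - p).
Proof. by move=> hk; have := impact_min 0 hk; rewrite scale0r subr0. Qed.

(** The distance to p and the speed do not jump while the radial speed increases, so
    the transverse part of the position decreases. *)
Lemma impact_step k : (k.+1 < K)%N -> 0 <= radial k + (tau k.+1 - tau k) ->
  impact k.+1 <= impact k.
Proof.
move=> hk h0; have hk' : (k < K)%N by lia.
rewrite -(@ler_pXn2r _ 2) ?nnegrE ?impact_ge0 // impact_sqr //.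
rewrite /impact -impact_flight // enorm_sqr; set D := X k.+1 - p.
rewrite !(dotpBl _ (_ *: _)) !(dotpBr _ (_ *: _)).
rewrite !dotpZl !dotpZr (bp_unit hp) // (dotpC (W k) D) radial_flight //.
have := radial_step hk; nra.
Qed.

Lemma radial_gt0 i j : (i <= j < K)%N -> 0 < radial i -> 0 < radial j.
Proof.
move=> h h0; apply: lt_le_trans (radial_mono h).
have := @tau_mono i j ltac:(lia); lra.
Qed.

(** The tangent of the angle between the velocity and the direction from p. *)
Definition aperture k := impact k / radial k.

(** The same at the vertex k.+1, before the jump. *)
Definition preaperture k := impact k / (radial k + (tau k.+1 - tau k)).

Lemma aperture_ge0 k : 0 < radial k -> 0 <= aperture k.
Proof. by move=> h; rewrite divr_ge0 ?impact_ge0 ?ltW. Qed.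

Lemma aperture_pre k : (k.+1 < K)%N -> 0 < radial k + (tau k.+1 - tau k) ->
  aperture k.+1 <= preaperture k.
Proof.
move=> hk h0; apply: ler_pM; rewrite ?impact_ge0 ?invr_ge0 ?impact_step ?(ltW h0) //.
  by apply: le_trans (radial_step hk); rewrite ltW.
by rewrite lef_pV2 ?posrE ?radial_step // (lt_le_trans h0) ?radial_step.
Qed.

Lemma preaperture_le k : (k < K)%N -> 0 < radial k -> preaperture k <= aperture k.
Proof.
move=> hk h0; have := bp_time hp hk => ht.
rewrite ler_wpM2l ?impact_ge0 // lef_pV2 ?posrE //; lra.
Qed.

Lemma aperture_mono i j : (i <= j < K)%N -> 0 < radial i -> aperture j <= aperture i.
Proof.
move=> /andP[ij]; elim: j ij => [|j IH].
  by rewrite leqn0 => /eqP ->.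
rewrite leq_eqVlt => /orP[/eqP -> //|ij jK h0].
have hj : 0 < radial j by apply: (@radial_gt0 i) => //; lia.
have hj' := bp_time hp (ltnW jK).
apply: le_trans (aperture_pre jK _) _; first by lra.
by apply: le_trans (preaperture_le _ hj) _; [lia|apply: IH => //; lia].
Qed.

(** Seen from p, a flight subtends an angle that is bounded by the loss of aperture, and a
    jump only rescales the comparison.  So the vertex s.+1, scaled towards p, comes
    close to the vertex i if the aperture hardly changes between them. *)
Lemma cone i s : (i <= s < K)%N -> 0 < radial i ->
  exists2 c : R, 0 <= c <= 1 &
    enorm (X i - p - c *: (X s.+1 - p)) <= impact i - radial i * preaperture s.
Proof.
move=> /andP[is_ sK]; move: {2}(s - i)%N (erefl (s - i)%N) => e.
elim: e i is_ => [|e IH] i is_ he h0.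
  have <- : i = s by lia.
  have ht := bp_time hp (k := i) ltac:(lia); have iK : (i < K)%N by lia.
  have hg : 0 < radial i + (tau i.+1 - tau i) by lra.
  exists (radial i / (radial i + (tau i.+1 - tau i))).
    by rewrite divr_ge0 ?(ltW h0) ?(ltW hg) //= ler_pdivrMr // mul1r; lra.
  set g := radial i; set g' := radial i + _.
  have -> : X i - p - (g / g') *: (X i.+1 - p) =
      (1 - g / g') *: (X i - p - g *: W i).
    have -> : X i.+1 - p = X i - p - g *: W i + g' *: W i.
      by rewrite -(impact_flight iK) subrK.
    rewrite scalerDr scalerA divfK ?gt_eqF // scalerBl scale1r opprD addrA.
    by rewrite [in RHS]addrAC.
  rewrite enormZ ger0_norm; last first.
    by rewrite subr_ge0 ler_pdivrMr // mul1r /g' /g; lra.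
  by rewrite /preaperture -/(impact i) -/g -/g' le_eqVlt; apply/orP; left; apply/eqP; ring.
have iK : (i < K)%N by lia.
have ht := bp_time hp iK.
have hg : 0 < radial i + (tau i.+1 - tau i) by lra.
have hr := @radial_step i ltac:(lia).
have h1 : 0 < radial i.+1 by lra.
have [c /andP[c0 c1] hc] := IH i.+1 ltac:(lia) ltac:(lia) h1.
set g := radial i; set g' := radial i + (tau i.+1 - tau i).
have mu0 : 0 <= g / g' by rewrite divr_ge0 ?ltW.
have mu1 : g / g' <= 1 by rewrite ler_pdivrMr // mul1r /g' /g; lra.
exists (g / g' * c).
  by rewrite mulr_ge0 //= mulr_ile1.
apply: le_trans (enorm_tri (g / g' *: (X i.+1 - p)) _ _) _.
have -> : X i - p - (g / g') *: (X i.+1 - p) =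
    (1 - g / g') *: (X i - p - g *: W i).
  have -> : X i.+1 - p = X i - p - g *: W i + g' *: W i.
    by rewrite -(impact_flight iK) subrK.
  rewrite scalerDr scalerA divfK ?gt_eqF // scalerBl scale1r opprD addrA.
  by rewrite [in RHS]addrAC.
rewrite -(scalerA (g / g') c) -scalerBr !enormZ !ger0_norm ?subr_ge0 //.
apply: le_trans (lerD (lexx _) (ler_wpM2l mu0 hc)) _.
rewrite -/(impact i); have him := @impact_step i ltac:(nlia) (ltW hg).
have hps : 0 <= preaperture s.
  rewrite divr_ge0 ?impact_ge0 //; have := bp_time hp sK.
  have := @radial_gt0 i s ltac:(nlia) h0; lra.
have e1 : g / g' * impact i.+1 <= g / g' * impact i by rewrite ler_wpM2l.
have e2 : g <= g / g' * radial i.+1.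
  by rewrite mulrAC ler_pdivlMr // ler_wpM2l // ltW.
have e3 : g * preaperture s <= g / g' * radial i.+1 * preaperture s by rewrite ler_wpM2r.
lra.
Qed.

End Center.
End Radial.

Arguments radial {R m} X W p k.
Arguments impact {R m} X W p k.
Arguments aperture {R m} X W p k.
Arguments preaperture {R m} tau X W p k.

(** * Comparison with a uniform motion inside the obstacles *)

Definition convex_body (R : realType) (m : nat) (C : set 'rV[R]_m) : Prop :=
  forall x y c, 0 <= c <= 1 -> C x -> C y -> C (x + c *: (y - x)).

Section DiscreteConvex.
Context {R : realType} {m : nat} {I : finType}.
Context {B : I -> set 'rV[R]_m} {S : {set I}} {K : nat}.
Context {tau : nat -> R} {X W : nat -> 'rV[R]_m} {lab : nat -> I}.
Hypothesis hp : billiard B S K tau X W lab.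
Variable r : nat -> R.

Definition secant k := (r k.+1 - r k) / (tau k.+1 - tau k).

Hypothesis hr : forall k, (k.+1 < K)%N -> secant k <= secant k.+1.

Lemma secantE k : (k < K)%N -> r k.+1 = r k + secant k * (tau k.+1 - tau k).
Proof.
move=> hk; rewrite divfK; first by rewrite addrC subrK.
by rewrite gt_eqF // subr_gt0 (bp_time hp).
Qed.

Lemma secant_mono i j : (i <= j < K)%N -> secant i <= secant j.
Proof.
move=> /andP[ij]; elim: j ij => [|j IH].
  by rewrite leqn0 => /eqP ->.
rewrite leq_eqVlt => /orP[/eqP -> //|ij jK].
by apply: le_trans (IH ij (ltnW jK)) (hr jK).
Qed.

Lemma secant_above k j : (k <= j <= K)%N -> (k < K)%N ->
  r k + secant k * (tau j - tau k) <= r j.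
Proof.
move=> /andP[kj]; elim: j kj => [|j IH].
  by rewrite leqn0 => /eqP ->; rewrite subrr mulr0 addr0.
rewrite leq_eqVlt => /orP[/eqP -> |kj jK kK]; first by rewrite subrr mulr0 addr0.
rewrite (secantE jK); have := IH kj (ltnW jK) kK.
have := @secant_mono k j ltac:(nlia); have := bp_time hp jK; nra.
Qed.

Lemma secant_below i k : (i <= k.+1 <= K)%N ->
  r k.+1 <= r i + secant k * (tau k.+1 - tau i).
Proof.
move=> h; move: {2}(k.+1 - i)%N (erefl (k.+1 - i)%N) => e.
elim: e i h => [|e IH] i h he.
  by have -> : i = k.+1 by [nlia]; rewrite subrr mulr0 addr0.
apply: le_trans (IH i.+1 ltac:(nlia) ltac:(nlia)) _.
have iK : (i < K)%N by nlia.
rewrite (secantE iK).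
have := @secant_mono i k ltac:(nlia); have := bp_time hp iK; nra.
Qed.

(** The secants before and after k bound the values at both ends from below, and the
    second secant is the larger one. *)
Lemma chord_above i k j : (i <= k <= j)%N -> (j <= K)%N ->
  r k * (tau j - tau i) <= r i * (tau j - tau k) + r j * (tau k - tau i).
Proof.
move=> h jK; case: k h => [|k] h.
  by have -> : i = 0%N by [nlia]; rewrite subrr mulr0 addr0.
have [e|hk] := eqVneq k.+1 j; first by rewrite e !subrr mulr0 add0r.
have h1 := @secant_below i k ltac:(nlia).
have h2 := @secant_above k.+1 j ltac:(nlia) ltac:(nlia).
have h3 := @hr k ltac:(nlia).
have t1 := @tau_mono _ _ _ _ _ _ _ _ _ _ hp i k.+1 ltac:(nlia).
have t2 := @tau_mono _ _ _ _ _ _ _ _ _ _ hp k.+1 j ltac:(nlia).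
set a := tau k.+1 - tau i in h1 *; set b := tau j - tau k.+1 in h2 *.
have -> : tau j - tau i = a + b by rewrite /a /b; ring.
have a0 : 0 <= a by rewrite subr_ge0.
have b0 : 0 <= b by rewrite subr_ge0.
have h4 : secant k * a * b <= secant k.+1 * b * a.
  by have := ler_wpM2r (mulr_ge0 a0 b0) h3; lra.
have h5 := ler_wpM2r b0 h1; have h6 := ler_wpM2r a0 h2; lra.
Qed.

End DiscreteConvex.

Section Chord.
Context {R : realType} {m : nat} {I : finType}.
Context {B : I -> set 'rV[R]_m} {S : {set I}} {K : nat}.
Context {tau : nat -> R} {X W : nat -> 'rV[R]_m} {lab : nat -> I}.
Hypothesis hp : billiard B S K tau X W lab.
Hypothesis K0 : (0 < K)%N.
Hypothesis Bconv : forall i, convex_body (B i).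
Context {p q : 'rV[R]_m}.
Hypothesis pc : core B S p.
Hypothesis qc : core B S q.

Let T := tau K - tau 0%N.
Let u := T^-1 *: (q - p).
(* the uniform motion from p to q in the time span of the path *)
Let P t := p + (t - tau 0%N) *: u.
Let D k := X k - P (tau k).
Let rho k := enorm (D k).
Let phi k := dotp (D k) (W k - u).

Lemma T_gt0 : 0 < T.
Proof. by rewrite subr_gt0; apply: (tau_lt hp); rewrite K0 /=. Qed.

Lemma chord_core k : (k <= K)%N -> core B S (P (tau k)).
Proof.
move=> hk i iS; rewrite /P /u scalerA; apply: Bconv; [|exact: pc|exact: qc].
have := T_gt0; have := tau_mono hp (i := 0) (j := k) ltac:(nlia).
have := tau_mono hp (i := k) (j := K) ltac:(nlia).
move=> h1 h2 h3; rewrite divr_ge0 ?subr_ge0 //=; last by rewrite -subr_ge0 ltW.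
by rewrite ler_pdivrMr // mul1r /T; lra.
Qed.

Lemma D_flight k : (k < K)%N -> D k.+1 = D k + (tau k.+1 - tau k) *: (W k - u).
Proof.
move=> hk; rewrite /D /P (bp_move hp) //; apply/rowP => i; rewrite !mxE; ring.
Qed.

Lemma D_end : D 0 = X 0 - p /\ D K = X K - q.
Proof.
rewrite /D /P subrr scale0r addr0; split=> //.
rewrite /u scalerA divff ?gt_eqF ?T_gt0 // scale1r.
by rewrite (addrC p) subrK.
Qed.

Let flight_gt0 k (hk : (k < K)%N) : 0 < tau k.+1 - tau k.
Proof. by rewrite subr_gt0 (bp_time hp). Qed.

Let sec := @secant R tau rho.

Lemma phi_le k : (k < K)%N -> phi k <= rho k * sec k.
Proof.
move=> hk; have l0 := flight_gt0 hk.
rewrite /sec /secant mulrA ler_pdivlMr //.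
have := cauchy_schwarz (D k.+1) (D k); rewrite {1}D_flight // dotpDl dotpZl.
by rewrite -enorm_sqr -/(rho k) -/(rho k.+1) (dotpC _ (D k)) -/(phi k); lra.
Qed.

Lemma phi_post k : (k < K)%N -> rho k.+1 * sec k <= dotp (D k.+1) (W k - u).
Proof.
move=> hk; have l0 := flight_gt0 hk.
rewrite /sec /secant mulrA ler_pdivrMr //.
have := cauchy_schwarz (D k.+1) (D k).
have -> : D k = D k.+1 - (tau k.+1 - tau k) *: (W k - u) by rewrite D_flight // addrK.
rewrite {1}dotpBr dotpZr -enorm_sqr -/(rho k.+1).
have -> : D k.+1 - (tau k.+1 - tau k) *: (W k - u) = D k by rewrite D_flight // addrK.
by rewrite -/(rho k); lra.
Qed.

Lemma phi_flight k : (k < K)%N -> dotp (D k.+1) (W k - u) =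
  phi k + (tau k.+1 - tau k) * dotp (W k - u) (W k - u).
Proof. by move=> hk; rewrite D_flight // dotpDl dotpZl. Qed.

(** The moving point P lies in all obstacles, hence jumps push away from it. *)
Lemma phi_jump k : (k.+1 < K)%N -> dotp (D k.+1) (W k - u) <= phi k.+1.
Proof.
move=> hk; have := bp_jump hp hk (chord_core (ltnW hk) (bp_lab hp (ltnW hk))).
rewrite -oppr_ge0 -dotpNr opprB -/(D k.+1) dotpC /phi !dotpBr; lra.
Qed.

(** On a flight the distance between two uniform motions is convex, and jumps only
    increase its slope. *)
Lemma rho_convex k : (k.+1 < K)%N -> sec k <= sec k.+1.
Proof.
move=> hk; have h1 := phi_le hk; have h2 := phi_jump hk.
have h3 := phi_post (ltnW hk).
have [h0|h0] := eqVneq (rho k.+1) 0.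
  rewrite /sec /secant h0 sub0r subr0; apply: (@le_trans _ _ 0).
    by rewrite mulNr oppr_le0 divr_ge0 ?enorm_ge0 // ltW // flight_gt0 // ltnW.
  by rewrite divr_ge0 ?enorm_ge0 // ltW // flight_gt0.
have r0 : 0 < rho k.+1 by rewrite lt_def h0 enorm_ge0.
by rewrite -(ler_pM2l r0); lra.
Qed.

Lemma rho_chord k : (k <= K)%N ->
  rho k * T <= enorm (X 0 - p) * (tau K - tau k) + enorm (X K - q) * (tau k - tau 0).
Proof.
move=> hk; have [<- <-] := D_end.
exact: (chord_above hp rho_convex (i := 0) (k := k) (j := K)).
Qed.

Lemma rho_bound M k : enorm (X 0 - p) <= M -> enorm (X K - q) <= M -> (k <= K)%N ->
  rho k <= M.
Proof.
move=> h0 hK hk; have := rho_chord hk; have := T_gt0.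
have := tau_mono hp (i := 0) (j := k) ltac:(nlia).
have := tau_mono hp (i := k) (j := K) ltac:(nlia).
move=> h1 h2 h3 h4; rewrite -(ler_pM2r h3); apply: (le_trans h4).
have -> : M * T = M * (tau K - tau k) + M * (tau k - tau 0) by rewrite /T; ring.
by apply: lerD; apply: ler_wpM2r => //; rewrite subr_ge0.
Qed.

(** Where the velocity relative to the uniform motion exceeds w, the derivative phi of
    half the squared distance grows at least at the rate w^2.  But the distance is
    convex and at most M, so phi is of the order of M^2 / T away from the ends; hence
    w is of the order of M / T.  A single flight longer than T / 6 has this relative
    velocity anyway, because its ends are within M of the uniform motion. *)
Lemma slow_flight M : enorm (X 0 - p) <= M -> enorm (X K - q) <= M ->
  exists k, [/\ (k < K)%N, tau 0%N + T / 3 <= tau k.+1, tau k <= tau K - T / 3 &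
    enorm (W k - u) <= 12 * M / T].
Proof.
move=> h0 hK; apply: contrapT => /forallNP hno.
have T0 := T_gt0.
have fast k : (k < K)%N -> tau 0%N + T / 3 <= tau k.+1 -> tau k <= tau K - T / 3 ->
    12 * M / T < enorm (W k - u).
  by move=> *; rewrite ltNge; apply/negP => hle; apply: (hno k).
have M0 : 0 <= M by apply: le_trans h0; apply: enorm_ge0.
have rb k : (k <= K)%N -> 0 <= rho k <= M.
  by move=> hk; rewrite enorm_ge0 rho_bound.
have hT : tau K = tau 0%N + T by rewrite /T; ring.
have short k : (k < K)%N -> tau 0%N + T / 3 <= tau k.+1 -> tau k <= tau K - T / 3 ->
    0 < M /\ tau k.+1 - tau k < T / 6.
  move=> hk ha hb; have hf := fast _ hk ha hb; have l0 := flight_gt0 hk.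
  have e : (tau k.+1 - tau k) * enorm (W k - u) <= 2 * M.
    have -> : (tau k.+1 - tau k) * enorm (W k - u) = enorm (D k.+1 - D k).
      by rewrite D_flight // (addrC (D k)) addrK enormZ gtr0_norm.
    apply: le_trans (enormD _ _) _; rewrite enormN.
    have /andP[_ ?] := rb k.+1 hk; have /andP[_ ?] := rb k (ltnW hk).
    by rewrite -/(rho k.+1) -/(rho k); lra.
  have e2 : (tau k.+1 - tau k) * (12 * M / T) < 2 * M.
    by apply: lt_le_trans e; rewrite ltr_pM2l.
  have e3 : (tau k.+1 - tau k) * (12 * M) < 2 * M * T.
    by rewrite -ltr_pdivrMr // -mulrA.
  have Mp : 0 < M.
    rewrite lt_neqAle M0 andbT; apply/eqP => Mz.
    by move: e2; rewrite -Mz !(mulr0,mul0r) ltxx.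
  by split => //; rewrite -(@ltr_pM2r _ (12 * M)) ?mulr_gt0 //; lra.
(* the flights k1 and k2 reach the end of the first and of the second third *)
have ex1 : exists k, (k <= K)%N && (tau 0%N + T / 3 <= tau k).
  by exists K; rewrite leqnn hT /=; lra.
have ex2 : exists k, (k <= K)%N && (tau K - T / 3 <= tau k).
  by exists K; rewrite leqnn /=; lra.
case: (ex_minnP ex1) => k1 /andP[k1K t1] min1.
case: (ex_minnP ex2) => k2 /andP[k2K t2] min2.
case: k1 k1K t1 min1 => [|k1] k1K t1 min1; first by lra.
case: k2 k2K t2 min2 => [|k2] k2K t2 min2; first by lra.
have t1' : tau k1 < tau 0%N + T / 3.
  by rewrite ltNge; apply/negP => h; have := min1 k1; rewrite h (ltnW k1K) ltnn => /(_ isT).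
have t2' : tau k2 < tau K - T / 3.
  by rewrite ltNge; apply/negP => h; have := min2 k2; rewrite h (ltnW k2K) ltnn => /(_ isT).
have [Mp s1] := short k1 k1K t1 ltac:(lra).
have [_ s2] := short k2 k2K ltac:(lra) (ltW t2').
have k12 : (k1.+1 <= k2.+1)%N by apply: min1; rewrite k2K /=; lra.
have k2K' : (k2.+1 < K)%N.
  by rewrite ltn_neqAle k2K andbT; apply/eqP => e; move: s2 t2'; rewrite e; lra.
have grow j : (k1.+1 <= j <= k2.+1)%N ->
    phi k1.+1 + (12 * M / T) ^+ 2 * (tau j - tau k1.+1) <= phi j.
  elim: j => // j IH /andP[]; rewrite leq_eqVlt => /orP[/eqP [<-] _|hj hj2].
    by rewrite subrr mulr0 addr0.
  have jK : (j.+1 < K)%N := leq_ltn_trans hj2 k2K'.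
  have jk2 : (j <= k2)%N := hj2.
  apply: le_trans (phi_jump jK); rewrite (phi_flight (ltnW jK)).
  have hj3 : _ <= _ := IH (introT andP (conj hj (ltnW hj2))).
  have ta := tau_mono hp (i := k1.+1) (j := j.+1) ltac:(clear -hj jk2 jK k2K; nlia).
  have tb := tau_mono hp (i := j) (j := k2) ltac:(clear -hj jk2 jK k2K; nlia).
  have hf := fast j ltac:(clear -hj jk2 jK k2K; nlia) ltac:(lra) ltac:(lra).
  have l0 := flight_gt0 (k := j) ltac:(clear -hj jk2 jK k2K; nlia).
  have hs : (12 * M / T) ^+ 2 <= dotp (W j - u) (W j - u).
    by rewrite -enorm_sqr ler_pXn2r ?nnegrE ?enorm_ge0 ?divr_ge0 ?mulr_ge0 ?(ltW hf) // ltW.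
  have := ler_wpM2l (ltW l0) hs; lra.
have g := grow k2.+1 (introT andP (conj k12 (leqnn _))).
have /andP[r1 r1'] := rb k1.+1 k1K.
have /andP[r2 r2'] := rb k2.+1 k2K.
have /andP[rz rz'] := rb 0%N (leq0n _).
have /andP[rK rK'] := rb K (leqnn _).
have u1 := phi_le k2K'.
have u2 := secant_above hp rho_convex (k := k2.+1) (j := K)
  ltac:(clear -k12 k1K k2K k2K'; nlia) k2K'.
have v1 : rho k1.+1 * sec k1 <= phi k1.+1.
  by apply: le_trans (phi_post k1K) (phi_jump (leq_ltn_trans k12 k2K')).
have v2 := secant_below hp rho_convex (i := 0) (k := k1) ltac:(clear -k12 k1K k2K k2K'; nlia).
rewrite -/sec in u2 v2.
have A1 : phi k2.+1 * (T / 6) <= M ^+ 2.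
  have [hneg|hpos] := lerP (phi k2.+1) 0.
    by apply: (@le_trans _ _ 0); rewrite ?sqr_ge0 // mulr_le0_ge0 // divr_ge0 // ltW.
  have d : T / 6 <= tau K - tau k2.+1 by lra.
  apply: (@le_trans _ _ (rho k2.+1 * sec k2.+1 * (tau K - tau k2.+1))).
    by apply: ler_pM => //; [exact: ltW|lra].
  rewrite -mulrA; apply: (@le_trans _ _ (rho k2.+1 * M)).
    by apply: ler_wpM2l => //; lra.
  by rewrite expr2; apply: ler_wpM2r.
have A2 : - M ^+ 2 <= phi k1.+1 * (T / 3).
  have [hpos|hneg] := lerP 0 (phi k1.+1).
    by apply: (@le_trans _ _ 0); rewrite ?oppr_le0 ?sqr_ge0 // mulr_ge0 // divr_ge0 // ltW.
  have d : T / 3 <= tau k1.+1 - tau 0%N by lra.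
  apply: (@le_trans _ _ (phi k1.+1 * (tau k1.+1 - tau 0%N))); last by rewrite ler_wnM2l // ltW.
  apply: (@le_trans _ _ (rho k1.+1 * sec k1 * (tau k1.+1 - tau 0%N))); last first.
    by apply: ler_wpM2r => //; lra.
  rewrite -mulrA; apply: (@le_trans _ _ (- (rho k1.+1 * M))).
    by rewrite lerN2 expr2; apply: ler_wpM2r.
  by rewrite -mulrN; apply: ler_wpM2l => //; lra.
have d : T / 6 <= tau k2.+1 - tau k1.+1 by lra.
have A3 : (12 * M / T) ^+ 2 * (T / 6) <= phi k2.+1 - phi k1.+1.
  apply: (@le_trans _ _ ((12 * M / T) ^+ 2 * (tau k2.+1 - tau k1.+1))); last by lra.
  by apply: ler_wpM2l => //; rewrite sqr_ge0.
have A4 : (12 * M / T) ^+ 2 * (T / 6) * (T / 6) = 4 * M ^+ 2 by field; rewrite gt_eqF.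
have A5 := ler_wpM2r (ltW (divr_gt0 T0 (ltr0n R 6 : 0 < 6 :> R))) A3.
have M2 : 0 < M ^+ 2 by rewrite exprn_gt0.
by rewrite A4 in A5; lra.
Qed.

(** For such a flight, seen from p, the aperture is of the order of M / T. *)
Lemma slow_flight_center M k : enorm (X 0 - p) <= M -> enorm (X K - q) <= M ->
  6 * M <= T -> (k < K)%N -> tau 0%N + T / 3 <= tau k.+1 ->
  enorm (W k - u) <= 12 * M / T ->
  T / 6 <= radial X W p k + (tau k.+1 - tau k) /\ impact X W p k <= 13 * M.
Proof.
move=> h0 hK hM kK ht hW; have T0 := T_gt0.
have t0 := tau_mono hp (i := 0) (j := k) ltac:(nlia).
have tK := tau_mono hp (i := k) (j := K) ltac:(nlia).
split.
  have h1 := radial_mono hp pc (i := 0) (j := k) ltac:(nlia).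
  have := radial_ge hp (p := p) (k := 0) K0; lra.
apply: le_trans (impact_min hp (p := p) (tau k - tau 0%N) kK) _.
have -> : X k - p - (tau k - tau 0%N) *: W k = D k - (tau k - tau 0%N) *: (W k - u).
  by apply/rowP => i; rewrite !mxE; ring.
apply: le_trans (enormD _ _) _; rewrite enormN enormZ ger0_norm ?subr_ge0 //.
have h1 := rho_bound h0 hK (ltnW kK).
have h2 : (tau k - tau 0%N) * enorm (W k - u) <= T * (12 * M / T).
  by apply: ler_pM => //; rewrite ?enorm_ge0 ?subr_ge0 // /T; lra.
have h3 : T * (12 * M / T) = 12 * M by field; rewrite gt_eqF.
by rewrite -/(rho k); lra.
Qed.

End Chord.

(** * Distance to the common points of the obstacles *)

Definition hits (I : finType) (S : {set I}) (lab : nat -> I) (i j : nat) : Prop :=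
  forall a, a \in S -> exists2 s, (i <= s <= j)%N & lab s = a.

Definition bodies_within (R : realType) (m : nat) (I : finType)
    (B : I -> set 'rV[R]_m) (S : {set I}) (x : 'rV[R]_m) (e : R) : Prop :=
  forall a, a \in S -> exists2 y, B a y & enorm (x - y) <= e.

Definition dist_core (R : realType) (m : nat) (I : finType)
    (B : I -> set 'rV[R]_m) (S : {set I}) (x : 'rV[R]_m) : R :=
  inf [set enorm (x - p) | p in core B S]%classic.

Section DistCore.
Context {R : realType} {m : nat} {I : finType}.
Context {B : I -> set 'rV[R]_m} {S : {set I}}.

Let im x := [set enorm (x - p) | p in core B S]%classic.

Let im_lb x : has_lbound (im x).
Proof. by exists 0 => _ [p _ <-]; exact: enorm_ge0. Qed.

Lemma dist_core_le x p : core B S p -> dist_core B S x <= enorm (x - p).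
Proof. by move=> hp; apply: ge_inf; [exact: im_lb|exists p]. Qed.

Hypothesis ne : (core B S !=set0)%classic.

Let im_ne x : (im x !=set0)%classic.
Proof. by case: ne => p hp; exists (enorm (x - p)), p. Qed.

Lemma dist_core_ge0 x : 0 <= dist_core B S x.
Proof. by apply: lb_le_inf; [exact: im_ne|move=> _ [p _ <-]; exact: enorm_ge0]. Qed.

Lemma dist_core_adh x e : 0 < e ->
  exists2 p, core B S p & enorm (x - p) < dist_core B S x + e.
Proof.
move=> e0; have [_ [p hp <-] h] := inf_adherent e0 (conj (im_ne x) (im_lb x)).
by exists p.
Qed.

End DistCore.

Section Counting.
Context {R : realType} {m : nat} {I : finType}.
Context {B : I -> set 'rV[R]_m} {S : {set I}}.
Hypothesis Bconv : forall i, convex_body (B i).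

Lemma billiard_prefix K K' tau X W lab : billiard B S K tau X W lab -> (K' <= K)%N ->
  billiard B S K' tau X W lab.
Proof.
move=> [hl hh ht hm hu hj hn] hK; split => [k hk|k hk|k hk|k hk|k hk|k y hk|k hk].
- by apply: hl; nlia.
- by apply: hh; nlia.
- by apply: ht; nlia.
- by apply: hm; nlia.
- by apply: hu; nlia.
- by apply: hj; nlia.
- by apply: hn; nlia.
Qed.

(** Scaling a vertex on an obstacle towards p stays in the obstacle, by convexity. *)
Lemma bodies_within_cone (S' : {set I}) K tau X W lab p i j :
  billiard B S K tau X W lab -> core B S p -> (i < j < K)%N -> hits S' lab i j ->
  0 < radial X W p i ->
  bodies_within B S' (X i) (impact X W p i - radial X W p i * aperture X W p j).
Proof.
move=> hp pc hij hh h0 a aS; have [s /andP[h1 h2] hs] := hh a aS.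
have hr : radial X W p i * aperture X W p j <= radial X W p i * aperture X W p i.
  by rewrite ler_pM2l // (aperture_mono hp) //; nlia.
have hr' : radial X W p i * aperture X W p i = impact X W p i.
  by rewrite mulrC divfK // gt_eqF.
have [e|ne] := eqVneq i s.
  exists (X i); first by rewrite -hs -e; apply: (bp_hit hp); nlia.
  by rewrite subrr enorm0; lra.
case: s h1 h2 hs ne => [|s] h1 h2 hs ne; first by nlia.
have [c c01 hc] := cone hp pc (i := i) (s := s) ltac:(nlia) h0.
exists (p + c *: (X s.+1 - p)).
  apply: Bconv => //; last by rewrite -hs; apply: (bp_hit hp); nlia.
  by apply: pc; rewrite -hs; apply: (bp_lab hp); nlia.
rewrite opprD addrA; apply: (le_trans hc).
rewrite lerD2l lerN2 ler_pM2l //.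
have rs := radial_gt0 hp pc (i := i) (j := s) ltac:(nlia) h0.
have ts := bp_time hp (k := s) ltac:(nlia).
apply: (@le_trans _ _ (aperture X W p s.+1)).
  by apply: (aperture_mono hp pc); [nlia|apply: (radial_gt0 hp pc (i := i)) => //; nlia].
by apply: (aperture_pre hp pc); [nlia|lra].
Qed.

Lemma bodies_within_time (S' : {set I}) K tau X W lab i j :
  billiard B S K tau X W lab -> (i <= j <= K)%N -> hits S' lab i j ->
  bodies_within B S' (X i) (tau j - tau i) /\
  bodies_within B S' (X j) (tau j - tau i).
Proof.
move=> hp hij hh; split=> a aS; have [s /andP[h1 h2] hs] := hh a aS;
  (exists (X s); first by rewrite -hs; apply: (bp_hit hp); nlia).
- rewrite enormB; apply: le_trans (X_lip hp (i := i) (j := s) ltac:(nlia)) _.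
  by rewrite lerD2r; apply: (tau_mono hp); nlia.
- apply: le_trans (X_lip hp (i := s) (j := j) ltac:(nlia)) _.
  by rewrite lerD2l lerN2; apply: (tau_mono hp); nlia.
Qed.

Hypothesis core_ne : (core B S !=set0)%classic.

Local Notation dist := (dist_core B S).

(** If the distance vanished at a vertex, both velocities at the next vertex would point
    radially away from it, and the path would not turn there. *)
Lemma dist_core_gt0 K tau X W lab k :
  billiard B S K tau X W lab -> (k.+1 < K)%N -> 0 < dist (X k).
Proof.
move=> hp hk; rewrite lt_def dist_core_ge0 // andbT; apply/eqP => h0.
have l0 : 0 < tau k.+1 - tau k by rewrite subr_gt0 (bp_time hp) // ltnW.
suff h : tau k.+1 - tau k <= (tau k.+1 - tau k) * dotp (W k) (W k.+1).
  apply: (bp_turn hp hk); apply/subr0_eq/dotp_eq0/le_anti; rewrite dotp_ge0 andbT.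
  rewrite !dotpE (bp_unit hp hk) (bp_unit hp (ltnW hk)) (dotpC (W k.+1)).
  by have : 1 <= dotp (W k) (W k.+1) by [rewrite -(ler_pM2l l0) mulr1]; lra.
apply/ler_addgt0Pr => e e0.
have [p pc hlt] := dist_core_adh core_ne (X k) (divr_gt0 e0 (ltr0n R 2)).
rewrite h0 add0r in hlt.
have h1 := radial_step hp pc hk; have h2 := radial_ge hp (p := p) (ltnW hk).
have h3 := cauchy_schwarz (X k - p) (W k.+1).
have h4 : (tau k.+1 - tau k) * dotp (W k) (W k.+1) =
    radial X W p k.+1 - dotp (X k - p) (W k.+1).
  rewrite /radial (bp_move hp (ltnW hk)) -dotpBl -dotpZl; congr dotp.
  by rewrite (addrAC (X k)) (addrC (X k - p)) addrK.
rewrite (unit_enorm hp hk) mulr1 in h3; lra.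
Qed.

(** The distance to the common points is convex in time: compare with the uniform
    motion between nearly closest points. *)
Lemma dist_core_chord K tau X W lab k :
  billiard B S K tau X W lab -> (k <= K)%N -> (0 < K)%N ->
  dist (X k) * (tau K - tau 0%N) <=
  dist (X 0%N) * (tau K - tau k) + dist (X K) * (tau k - tau 0%N).
Proof.
move=> hp hk K0; apply/ler_addgt0Pr => e e0.
have T0 : 0 < tau K - tau 0%N by rewrite subr_gt0; apply: (tau_lt hp); rewrite K0 /=.
have d0 : 0 < e / (tau K - tau 0%N) by rewrite divr_gt0.
have [p pc hp'] := dist_core_adh core_ne (X 0%N) d0.
have [q qc hq'] := dist_core_adh core_ne (X K) d0.
have h1 := dist_core_le (X k) (chord_core hp K0 Bconv pc qc hk).
have h2 := rho_chord hp K0 Bconv pc qc hk.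
have t1 : 0 <= tau k - tau 0%N by rewrite subr_ge0 (tau_mono hp) //; nlia.
have t2 : 0 <= tau K - tau k by rewrite subr_ge0 (tau_mono hp) //; nlia.
have h3 := ler_wpM2r (ltW T0) h1.
apply: (le_trans h3); apply: (le_trans h2).
have h4 := ler_wpM2r t2 (ltW hp'); have h5 := ler_wpM2r t1 (ltW hq').
apply: (le_trans (lerD h4 h5)); rewrite le_eqVlt; apply/orP; left; apply/eqP.
by field; rewrite gt_eqF.
Qed.

Context {A : R}.
Hypothesis A1 : 1 <= A.

Section Grid.
Context {N q : nat}.
Hypothesis q0 : (0 < q)%N.
Context {tau : nat -> R} {X W : nat -> 'rV[R]_m} {lab : nat -> I}.
Hypothesis hp : billiard B S (N * q) tau X W lab.
Context {Sg : nat -> {set I}} {f : nat -> R}.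
Hypothesis hh : forall j, (j < N)%N -> hits (Sg j) lab (j * q) (j.+1 * q).
Hypothesis hf : forall j e, (j < N)%N -> 0 <= e ->
  bodies_within B (Sg j) (X (j * q)%N) e -> f j <= A * e.

Let t j := tau (j * q)%N.

Let leqq i j : (i <= j)%N -> (i * q <= j * q)%N.
Proof. by move=> ?; rewrite leq_pmul2r. Qed.

Lemma grid_time j j' : (j <= j' <= N)%N -> t j <= t j'.
Proof.
by move=> /andP[h1 h2]; apply: (tau_mono hp); rewrite !leqq.
Qed.

(** If a stretch near all its obstacles within e has f <= A e, it consumes at least
    f / (A radial) of the aperture, and the aperture at the start is a budget for
    all the stretches that follow. *)
Lemma forward_steps p s al j0 j1 : core B S p -> (j0 <= j1)%N -> (j1 < N)%N ->
  0 < radial X W p (j0 * q) -> aperture X W p (j0 * q) <= al ->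
  (forall j, (j0 <= j < j1)%N -> s * radial X W p (j * q) <= f j) ->
  (j1%:R - j0%:R) * s <= A * al.
Proof.
move=> pc h01 h1 hr hal hs.
suff h : (j1%:R - j0%:R) * s <=
    A * (aperture X W p (j0 * q) - aperture X W p (j1 * q)).
  have hr1 : 0 < radial X W p (j1 * q).
    by apply: (radial_gt0 hp pc (i := (j0 * q)%N)) => //; rewrite leqq ?ltn_pmul2r.
  have := aperture_ge0 hr1; have := le_trans ler01 A1; move=> a0 a1.
  apply: (le_trans h); apply: ler_wpM2l => //; lra.
elim: j1 h01 h1 hs => [|j1 IH] h01 h1 hs.
  by have -> : j0 = 0%N by [nlia]; rewrite !subrr mul0r mulr0.
have [->|ne] := eqVneq j0 j1.+1; first by rewrite !subrr mul0r mulr0.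
have h01' : (j0 <= j1)%N by nlia.
have {}IH := IH h01' ltac:(nlia) (fun j hj => hs j ltac:(nlia)).
have hr1 : 0 < radial X W p (j1 * q).
  apply: (radial_gt0 hp pc (i := (j0 * q)%N)) => //.
  by rewrite leqq //= ltn_pmul2r //; nlia.
have hw := bodies_within_cone hp pc (i := (j1 * q)%N) (j := (j1.+1 * q)%N)
  ltac:(by rewrite !ltn_pmul2r // leqnn) (hh (ltnW h1)) hr1.
have e : impact X W p (j1 * q) = radial X W p (j1 * q) * aperture X W p (j1 * q).
  by rewrite mulrC divfK // gt_eqF.
rewrite e -mulrBr in hw.
have am : aperture X W p (j1.+1 * q) <= aperture X W p (j1 * q).
  by apply: (aperture_mono hp pc) => //; rewrite leqq //= ltn_pmul2r.
rewrite -subr_ge0 in am; have hb := hf (ltnW h1) (mulr_ge0 (ltW hr1) am) hw.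
have h := le_trans (hs j1 ltac:(nlia)) hb.
rewrite mulrCA (mulrC s) ler_pM2l // in h.
rewrite -natr1; lra.
Qed.

Lemma time_steps F j0 j1 : (j0 <= j1 <= N)%N ->
  (forall j, (j0 <= j < j1)%N -> F <= f j) ->
  (j1%:R - j0%:R) * F <= A * (t j1 - t j0).
Proof.
elim: j1 => [|j1 IH] h01 hF.
  by have -> : j0 = 0%N by [nlia]; rewrite !subrr mul0r mulr0.
have [->|ne] := eqVneq j0 j1.+1; first by rewrite !subrr mul0r mulr0.
have {}IH := IH ltac:(nlia) (fun j hj => hF j ltac:(nlia)).
have [hw _] := bodies_within_time hp (i := (j1 * q)%N) (j := (j1.+1 * q)%N)
  ltac:(by rewrite !leqq //; nlia) (hh (j := j1) ltac:(nlia)).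
have tm := grid_time (j := j1) (j' := j1.+1) ltac:(nlia).
rewrite -subr_ge0 in tm; have hd := hf (j := j1) ltac:(nlia) tm hw.
have := le_trans (hF j1 ltac:(nlia)) hd.
rewrite -natr1 -/(t j1) -/(t j1.+1); lra.
Qed.

End Grid.

Hypothesis retract : forall x e, 0 <= e -> bodies_within B S x e ->
  exists2 p, core B S p & enorm (x - p) <= A * e.

Lemma dist_core_bodies x e : 0 <= e -> bodies_within B S x e -> dist x <= A * e.
Proof.
by move=> e0 /(retract e0)[p pc h]; apply: le_trans (dist_core_le x pc) h.
Qed.

Section DistGrid.
Context {N q : nat} {tau : nat -> R} {X W : nat -> 'rV[R]_m} {lab : nat -> I}.
Hypothesis q0 : (0 < q)%N.
Hypothesis hp : billiard B S (N * q) tau X W lab.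
Hypothesis hh : forall j, (j < N)%N -> hits S lab (j * q) (j.+1 * q).

Let dist_grid j e (_ : (j < N)%N) (e0 : 0 <= e)
  (hw : bodies_within B S (X (j * q)%N) e) : dist (X (j * q)%N) <= A * e :=
  dist_core_bodies e0 hw.

Definition forward_count := forward_steps q0 hp hh dist_grid.
Definition time_count := time_steps q0 hp hh dist_grid.

End DistGrid.

End Counting.

(** * Stretches at comparable and at growing distance *)

Section Flat.
Context {R : realType} {m : nat} {I : finType}.
Context {B : I -> set 'rV[R]_m} {S : {set I}} {A : R}.
Hypothesis Bconv : forall i, convex_body (B i).
Hypothesis core_ne : (core B S !=set0)%classic.
Hypothesis A1 : 1 <= A.
Hypothesis retract : forall x e, 0 <= e -> bodies_within B S x e ->
  exists2 p, core B S p & enorm (x - p) <= A * e.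

Local Notation dist := (dist_core B S).

Lemma center_bound K tau X W lab p k : billiard B S K tau X W lab -> (k <= K)%N ->
  enorm (X k - p) <= enorm (X 0%N - p) + (tau k - tau 0%N).
Proof.
move=> hp hk; apply: le_trans (enorm_tri (X 0%N) _ _) _.
by rewrite addrC lerD2l (X_lip hp).
Qed.

Lemma aperture_after K tau X W lab p k i (M T : R) :
  billiard B S K tau X W lab -> core B S p ->
  (k < i < K)%N -> 0 < T -> 0 <= M ->
  T / 6 <= radial X W p k + (tau k.+1 - tau k) -> impact X W p k <= 13 * M ->
  0 < radial X W p i /\ aperture X W p i <= 78 * M / T.
Proof.
move=> hp pc hik T0 M0 h1 h2.
have T6 : 0 < T / 6 by lra.
have r1 := radial_step hp pc (k := k) ltac:(nlia).
have r1p : 0 < radial X W p k.+1 by lra.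
split; first by apply: (radial_gt0 hp pc (i := k.+1)) => //; nlia.
apply: le_trans (aperture_mono hp pc (i := k.+1) (j := i) ltac:(nlia) r1p) _.
apply: le_trans (aperture_pre hp pc (k := k) ltac:(nlia) ltac:(lra)) _.
rewrite /preaperture ler_pdivrMr; last by lra.
apply: (le_trans h2); have -> : 13 * M = 78 * M / T * (T / 6) by field; rewrite gt_eqF.
by apply: ler_wpM2l => //; rewrite divr_ge0 ?mulr_ge0 // ltW.
Qed.

(** After the slow flight k the aperture seen from p is of the order of F / T, and each
    stretch consumes at least the order of F / (A T) of it. *)
Lemma flat_count_after N q tau X W lab F p p' k j0 :
  (0 < q)%N -> billiard B S (N * q) tau X W lab ->
  (forall j, (j < N)%N -> hits S lab (j * q) (j.+1 * q)) ->
  core B S p -> core B S p' -> 0 < F ->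
  enorm (X 0%N - p) <= 4 * F -> enorm (X (N * q)%N - p') <= 4 * F ->
  24 * F <= tau (N * q)%N - tau 0%N ->
  (forall j, (j <= N)%N -> F <= dist (X (j * q)%N)) ->
  (k < N * q)%N -> tau 0%N + (tau (N * q)%N - tau 0%N) / 3 <= tau k.+1 ->
  enorm (W k - (tau (N * q)%N - tau 0%N)^-1 *: (p' - p)) <=
    12 * (4 * F) / (tau (N * q)%N - tau 0%N) ->
  (k < j0 * q)%N -> N%:R - 1 - j0%:R <= 364 * A.
Proof.
move=> q0 hp hh pc p'c F0 h0 h1 hT hf hk ht hW hj.
set T := tau (N * q)%N - tau 0%N in hT ht hW *.
have A0 : 0 <= A by apply: le_trans ler01 A1.
have T0 : 0 < T by lra.
have [hs|hs] := leqP N j0.+1.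
  apply: (@le_trans _ _ 0); last by apply: mulr_ge0 A0; exact: ler0n.
  by move: hs; rewrite -(ler_nat R) -natr1; lra.
have hM : 6 * (4 * F) <= T by lra.
have [hr hi] := slow_flight_center hp (leq_ltn_trans (leq0n k) hk) Bconv pc p'c
  h0 h1 hM hk ht hW.
rewrite -/T in hr.
have hjK : (j0 * q < N * q)%N by rewrite ltn_pmul2r //; nlia.
have hik : (k < j0 * q < N * q)%N by rewrite hj hjK.
have F4 : 0 <= 4 * F by lra.
have [rp ap] := aperture_after hp pc hik T0 F4 hr hi.
have s0 : 0 < 6 / 7 * F / T by rewrite divr_gt0 // mulr_gt0 //; lra.
have := forward_count Bconv A1 retract q0 hp hh (j0 := j0) (j1 := N.-1)
   (s := 6 / 7 * F / T) pc ltac:(nlia) ltac:(nlia) rp ap.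
have eN : N.-1%:R = N%:R - 1 :> R by rewrite -subn1 natrB //; nlia.
rewrite eN => H; rewrite addrAC in H *; rewrite -(ler_pM2r s0).
have -> : 364 * A * (6 / 7 * F / T) = A * (78 * (4 * F) / T) by field; rewrite gt_eqF.
rewrite addrAC in H *.
apply: H => j hj'; apply: le_trans (hf j _); last by nlia.
have jK : (j * q < N * q)%N by rewrite ltn_pmul2r //; nlia.
have b1 := radial_le hp (p := p) jK.
have b2 := center_bound p hp (ltnW jK).
have b3 := tau_mono hp (i := (j * q)%N) (j := (N * q)%N) ltac:(nlia).
have b4 : radial X W p (j * q) <= 7 / 6 * T by rewrite /T; rewrite /T in hT; lra.
apply: le_trans (ler_wpM2l (ltW s0) b4) _.
by rewrite le_eqVlt; apply/orP; left; apply/eqP; field; rewrite gt_eqF.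
Qed.

Lemma hits_rev lab K i j : hits S lab i j -> (j <= K)%N ->
  hits S (fun k => lab (K - k)%N) (K - j) (K - i).
Proof.
move=> h hK a aS; have [s hs e] := h a aS; exists (K - s)%N; first by nlia.
by rewrite -e; congr lab; nlia.
Qed.

Lemma hits_grid_rev N q lab :
  (forall j, (j < N)%N -> hits S lab (j * q) (j.+1 * q)) ->
  forall j, (j < N)%N ->
    hits S (fun k => lab (N * q - k)%N) (j * q) (j.+1 * q).
Proof.
move=> hh j hj; have := hits_rev (K := (N * q)%N) (hh (N - j.+1)%N ltac:(nlia)).
rewrite leq_mul2r; have -> : ((N - j.+1).+1 <= N)%N by nlia.
rewrite orbT -!mulnBl => /(_ isT).
have -> : (N - (N - j.+1).+1 = j)%N by nlia.
by have -> : (N - (N - j.+1) = j.+1)%N by nlia.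
Qed.

(** Both halves are counted from the slow flight, the first one backwards in time.  If T
    is not large compared with F, then the durations are enough: each is at least F / A. *)
Lemma flat_count N q tau X W lab F :
  (0 < q)%N -> billiard B S (N * q) tau X W lab ->
  (forall j, (j < N)%N -> hits S lab (j * q) (j.+1 * q)) ->
  0 < F -> (forall j, (j <= N)%N -> F <= dist (X (j * q)%N)) ->
  dist (X 0%N) <= 2 * F -> dist (X (N * q)%N) <= 2 * F ->
  N%:R <= 728 * A + 3.
Proof.
move=> q0 hp hh F0 hf h0 h1.
have A0 : 0 <= A by apply: le_trans ler01 A1.
case: (posnP N) => [->|N0]; first by lra.
set T := tau (N * q)%N - tau 0%N.
have [hT|hT] := lerP T (24 * F).
  have := time_count retract q0 hp hh (j0 := 0) (j1 := N) ltac:(nlia)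
    (fun j hj => hf j ltac:(nlia)).
  rewrite mul0n -/T subr0 => h.
  have : N%:R * F <= (24 * A) * F.
    by apply: (le_trans h); have := ler_wpM2l A0 hT; lra.
  by rewrite ler_pM2r //; lra.
have F2 : 0 < 2 * F by lra.
have [p pc hp0] := dist_core_adh core_ne (X 0%N) F2.
have [p' pc' hp1] := dist_core_adh core_ne (X (N * q)%N) F2.
have e0 : enorm (X 0%N - p) <= 4 * F by lra.
have e1 : enorm (X (N * q)%N - p') <= 4 * F by lra.
have K0 : (0 < N * q)%N by rewrite muln_gt0 N0.
have [k [hk ha hb hc]] := slow_flight hp K0 Bconv pc pc' e0 e1.
rewrite -/T in ha hb hc.
have kq : (k %/ q < N)%N by rewrite ltn_divLR.
have fwd := flat_count_after q0 hp hh pc pc' F0 e0 e1 (ltW hT) hf hk ha hc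
  (ltn_ceil k q0).
have hp' := billiard_rev hp; have hh' := hits_grid_rev hh.
have eT : - tau (N * q - N * q)%N - - tau (N * q - 0)%N = T.
  by rewrite subnn subn0 /T; ring.
have bwd := flat_count_after (F := F) (p := p') (p' := p) (k := (N * q - k.+1)%N)
  (j0 := (N - k %/ q)%N) q0 hp' hh' pc' pc F0.
rewrite eT subnn subn0 in bwd.
have kk : ((N * q - k.+1).+1 = N * q - k)%N by nlia.
have kk' : (N * q - (N * q - k.+1).+1 = k)%N by nlia.
rewrite kk' kk in bwd.
have := bwd e1 e0 (ltW hT).
have e2 : enorm (- W k - T^-1 *: (p - p')) <= 12 * (4 * F) / T.
  rewrite (_ : - W k - _ = - (W k - T^-1 *: (p' - p))) ?enormN //.
  by apply/rowP => i; rewrite !mxE; ring.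
have hf' j : (j <= N)%N -> F <= dist (X (N * q - j * q)%N).
  by move=> hj; rewrite -mulnBl; apply: hf; nlia.
have kq' : (N * q - k <= (N - k %/ q) * q)%N.
  rewrite mulnBl; have := leq_trunc_div k q; nlia.
move=> /(_ hf' ltac:(nlia) ltac:(rewrite /T in hb *; lra) e2 kq').
rewrite natrB; last by nlia.
by rewrite -natr1 in fwd; lra.
Qed.

(** After the last grid point b with f <= 2 F, the distance to the common points is at least
    F1 / (2 T) times the length travelled from the start, by convexity; here F1 is its
    value at b.+1 and T the length travelled until then.  The aperture seen from a common
    point near the start is at most of the same order F1 / T. *)
Lemma growing_count N q tau X W lab F b :
  (0 < q)%N -> billiard B S (N * q) tau X W lab ->
  (forall j, (j < N)%N -> hits S lab (j * q) (j.+1 * q)) ->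
  0 < F -> (forall j, (j <= N)%N -> F <= dist (X (j * q)%N)) ->
  dist (X 0%N) <= F -> (b <= N)%N ->
  (forall j, (b < j <= N)%N -> 2 * F < dist (X (j * q)%N)) ->
  N%:R <= b%:R + 364 * A + 3.
Proof.
move=> q0 hp hh F0 hf h0 hbN hb.
have A0 : 0 <= A by apply: le_trans ler01 A1.
have [e|bN] := eqVneq b N; first by rewrite e; lra.
have {bN} bN : (b < N)%N by nlia.
have [hs|hs] := leqP N b.+2.
  by move: hs; rewrite -(ler_nat R) -!natr1; lra.
pose t j := tau (j * q)%N.
pose f j := dist (X (j * q)%N).
have leqq i j : (i <= j)%N -> (i * q <= j * q)%N by move=> ?; rewrite leq_pmul2r.
have ltqq i j : (i < j)%N -> (i * q < j * q)%N by move=> ?; rewrite ltn_pmul2r.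
have tz : tau 0%N = t 0%N by rewrite /t mul0n.
have tm i j : (i <= j <= N)%N -> t i <= t j.
  by move=> /andP[? ?]; apply: (tau_mono hp); rewrite !leqq.
set F1 := f b.+1; set T := t b.+1 - t 0%N.
have F1F : 2 * F < F1 by apply: hb; nlia.
have T0 : 0 < T.
  by rewrite subr_gt0 /t mul0n; apply: (tau_lt hp); rewrite muln_gt0 q0 /= leqq.
(* the distance has at least doubled at b.+1, so half of F1 is growth *)
have conv j : (b < j <= N)%N -> F1 * (t j - t 0%N) <= 2 * T * f j.
  move=> hj; have jN : (j * q <= N * q)%N by apply: leqq; nlia.
  have := dist_core_chord Bconv core_ne (k := (b.+1 * q)%N)
    (billiard_prefix hp jN) (leqq b.+1 j ltac:(nlia)) ltac:(rewrite muln_gt0 q0; nlia).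
  rewrite -/(f j) -/(t j) -/(t b.+1) -/(f b.+1) -/F1 tz -/T => h1.
  have h2 := tm b.+1 j ltac:(nlia).
  have h3 : dist (X 0%N) * (t j - t b.+1) <= F * (t j - t b.+1).
    by apply: ler_wpM2r => //; lra.
  have h4 : F * (t j - t b.+1) <= F * (t j - t 0%N).
    by apply: ler_wpM2l; [exact: ltW|rewrite /T in T0; lra].
  have h5 : 2 * F * (t j - t 0%N) <= F1 * (t j - t 0%N).
    by apply: ler_wpM2r; [rewrite /T in T0; lra|exact: ltW].
  lra.
have eN : N.-1%:R = N%:R - 1 :> R by rewrite -subn1 natrB //; nlia.
have [p pc hp0] := dist_core_adh core_ne (X 0%N) F0.
have [hT|hT] := lerP (12 * F1) T.
  have F1p : 0 < F1 by lra.
  have [p' pc' hp1] := dist_core_adh core_ne (X (b.+1 * q)%N) F1p.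
  rewrite -/(f _) -/F1 in hp1.
  have bq : (b.+1 * q <= N * q)%N by apply: leqq.
  have hp2 := billiard_prefix hp bq.
  have K0 : (0 < b.+1 * q)%N by rewrite muln_gt0.
  have e0 : enorm (X 0%N - p) <= 2 * F1 by lra.
  have e1 : enorm (X (b.+1 * q)%N - p') <= 2 * F1 by lra.
  have [k [hk ha hb' hc]] := slow_flight hp2 K0 Bconv pc pc' e0 e1.
  have hM : 6 * (2 * F1) <= tau (b.+1 * q)%N - tau 0%N.
    by rewrite -/(t _) tz -/T; lra.
  have [hr hi] := slow_flight_center hp2 K0 Bconv pc pc' e0 e1
    hM hk ha hc.
  rewrite -/(t _) tz -/T in hr.
  have hik : (k < b.+1 * q < N * q)%N by rewrite hk /=; apply: ltqq; nlia.
  have F2 : 0 <= 2 * F1 by lra.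
  have [rp ap] := aperture_after hp pc hik T0 F2 hr hi.
  have s0 : 0 < 3 / 7 * F1 / T by rewrite divr_gt0 // mulr_gt0 //; lra.
  have := forward_count Bconv A1 retract q0 hp hh (j0 := b.+1) (j1 := N.-1)
     (s := 3 / 7 * F1 / T) pc ltac:(nlia) ltac:(nlia) rp ap.
  have -> : A * (78 * (2 * F1) / T) = 364 * A * (3 / 7 * F1 / T).
    by field; rewrite gt_eqF.
  rewrite (ler_pM2r s0) eN => H.
  suff : N%:R - 1 - b.+1%:R <= 364 * A by rewrite -[b.+1%:R]natr1; lra.
  apply: H => j hj.
  have jK : (j * q < N * q)%N by apply: ltqq; nlia.
  have b1 := radial_le hp (p := p) jK.
  have b2 := center_bound p hp (ltnW jK).
  have b3 := tm b.+1 j ltac:(nlia).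
  rewrite -/(t j) tz in b2.
  have b4 : radial X W p (j * q) <= 7 / 6 * (t j - t 0%N) by rewrite /T in hT; lra.
  apply: le_trans (ler_wpM2l (ltW s0) b4) _.
  rewrite -(@ler_pM2r _ (2 * T)) ?mulr_gt0 //.
  have -> : 3 / 7 * F1 / T * (7 / 6 * (t j - t 0%N)) * (2 * T) = F1 * (t j - t 0%N).
    by field; rewrite gt_eqF.
  by rewrite [X in _ <= X]mulrC; apply: conv; nlia.
(* here the distance is a fixed part of the length travelled; an aperture of
   order 1 is reached as soon as this length exceeds 4 F *)
have far j : (b < j <= N)%N -> (t j - t 0%N) / 24 <= f j.
  move=> hj; have h1 := conv j hj; have h2 := tm b.+1 j ltac:(nlia).
  rewrite -(@ler_pM2r _ (2 * T)) ?mulr_gt0 //.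
  rewrite [f j * _]mulrC; apply: le_trans h1.
  have h3 : 0 <= t j - t 0%N by rewrite /T in T0; lra.
  have h4 := ler_wpM2r h3 (ltW hT); lra.
have tc j : (j <= N)%N -> j%:R * F <= A * (t j - t 0%N).
  move=> hj; have := time_count retract q0 hp hh (F := F) (j0 := 0) (j1 := j) ltac:(nlia)
    (fun i hi => hf i ltac:(nlia)).
  by rewrite -/(t j) -/(t 0%N) subr0.
have tc' j : (j <= N)%N -> t j - t 0%N < 4 * F -> j%:R <= 4 * A.
  move=> hj h4; rewrite -(ler_pM2r F0); apply: le_trans (tc j hj) _.
  by have := ler_wpM2l A0 (ltW h4); lra.
have [hN|hN] := ltP (t N - t 0%N) (4 * F).
  by have := tc' N (leqnn _) hN; have := ler0n R b; lra.
have ex0 : exists j, [&& (b < j)%N, (j <= N)%N & 4 * F <= t j - t 0%N].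
  by exists N; rewrite bN leqnn.
case: (ex_minnP ex0) => j0 /and3P[bj jN hj0] minj.
have hj0' : j0%:R <= b%:R + 1 + 4 * A + 1.
  case: (ltnP b.+1 j0) => hbj; last first.
    by have := hbj; rewrite -(ler_nat R) -natr1; lra.
  have hlt : t j0.-1 - t 0%N < 4 * F.
    rewrite ltNge; apply/negP => hge.
    by have := minj j0.-1; rewrite hge andbT => /(_ ltac:(nlia)); nlia.
  have := tc' j0.-1 ltac:(nlia) hlt.
  have -> : j0.-1%:R = j0%:R - 1 :> R by rewrite -subn1 natrB //; nlia.
  by have := ler0n R b; lra.
have [hs2|hs2] := leqP N j0.+1.
  by move: hs2; rewrite -(ler_nat R) -natr1; lra.
have near j : (j0 <= j < N)%N -> (t j - t 0%N) / 2 <= radial X W p (j * q) /\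
    enorm (X (j * q)%N - p) <= 3 / 2 * (t j - t 0%N).
  move=> hj.
  have jK : (j * q < N * q)%N by apply: ltqq; nlia.
  have b2 := center_bound p hp (ltnW jK).
  have b3 := tm j0 j ltac:(nlia).
  have b4 := radial_mono hp pc (i := 0) (j := (j * q)%N) ltac:(nlia).
  have b5 := radial_ge hp (p := p) (k := 0) ltac:(nlia).
  by rewrite -/(t j) tz in b2 b4; split; lra.
have [n1 n2] := near j0 ltac:(nlia).
have rp : 0 < radial X W p (j0 * q) by lra.
have ap : aperture X W p (j0 * q) <= 3.
  rewrite ler_pdivrMr //.
  have := impact_le hp (p := p) (ltqq j0 N ltac:(nlia)); lra.
have := forward_count Bconv A1 retract q0 hp hh (j0 := j0) (j1 := N.-1)
   (s := 1 / 36) pc ltac:(nlia) ltac:(nlia) rp ap.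
rewrite eN => H.
suff : (N%:R - 1 - j0%:R) * (1 / 36) <= A * 3 by lra.
apply: H => j hj.
have [_ n3] := near j ltac:(nlia).
have b1 := radial_le hp (p := p) (ltqq j N ltac:(nlia)).
have := far j ltac:(nlia); rewrite /f; lra.
Qed.

End Flat.

(** * The local bound *)

Section Total.
Context {R : realType} {m : nat} {I : finType}.
Context {B : I -> set 'rV[R]_m} {A : R}.
Hypothesis Bconv : forall i, convex_body (B i).
Hypothesis A1 : 1 <= A.

Lemma hits_sub (S : {set I}) lab i j l : hits S lab (l + i) (l + j) ->
  hits S (fun k => lab (l + k)%N) i j.
Proof.
move=> h a aS; have [s hs e] := h a aS; exists (s - l)%N; first by nlia.
by rewrite -e; congr lab; nlia.
Qed.

Section Fixed.
Context {S : {set I}}.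
Hypothesis core_ne : (core B S !=set0)%classic.
Hypothesis retract : forall x e, 0 <= e -> bodies_within B S x e ->
  exists2 p, core B S p & enorm (x - p) <= A * e.

Local Notation dist := (dist_core B S).

Lemma dist_core_gt0_all K tau X W lab k :
  billiard B S K tau X W lab -> (3 <= K)%N -> (k <= K)%N -> 0 < dist (X k).
Proof.
move=> hp K3 kK; have [h|h] := ltnP k.+1 K; first exact: (dist_core_gt0 core_ne hp).
have := dist_core_gt0 core_ne (billiard_rev hp) (k := (K - k)%N) ltac:(nlia).
by rewrite subKn.
Qed.

(** Let F be the minimum of f.  The stretches between the first and the last with
    f <= 2 F are counted by the flat case, the others by the growing case, on both
    sides of the minimum. *)
Lemma total_count N q tau X W lab :
  (0 < q)%N -> billiard B S (N * q) tau X W lab ->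
  (forall j, (j < N)%N -> hits S lab (j * q) (j.+1 * q)) ->
  N%:R <= 1456 * A + 9.
Proof.
move=> q0 hp hh.
have [hN|hN] := leqP N 2.
  by move: hN; rewrite -(ler_nat R) => hN; have := A1; lra.
pose f j := dist (X (j * q)%N).
have leqq i j : (i <= j)%N -> (i * q <= j * q)%N by move=> ?; rewrite leq_pmul2r.
have f0 j : (j <= N)%N -> 0 < f j.
  move=> hj; apply: (dist_core_gt0_all hp); last exact: leqq.
  by apply: leq_trans hN _; rewrite leq_pmulr.
have [s hs hmin] : exists2 s, (s <= N)%N & forall j, (j <= N)%N -> f s <= f j.
  case: (arg_minP (fun i : 'I_N.+1 => f i) (i0 := ord0) (P := predT) isT) => i _ hi.
  by exists i => [|j hj]; [rewrite -ltnS|exact: (hi (Ordinal (hj : (j < N.+1)%N)) isT)].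
have F0 := f0 s hs; set F := f s in hmin F0.
have fs : f s <= 2 * F by rewrite -/F; lra.
have exb : exists j, (j <= N)%N && (f j <= 2 * F) by exists s; rewrite hs fs.
have bdb j : (j <= N)%N && (f j <= 2 * F) -> (j <= N)%N by case/andP.
case: (ex_maxnP exb bdb) => b /andP[bN fb] maxb.
case: (ex_minnP exb) => b' /andP[b'N fb'] minb.
have b's : (b' <= s)%N by apply: minb; rewrite hs fs.
have sb : (s <= b)%N by apply: maxb; rewrite hs fs.
have shiftp i j : (i <= j <= N)%N ->
    billiard B S ((j - i) * q) (fun k => tau (i * q + k)%N) (fun k => X (i * q + k)%N)
      (fun k => W (i * q + k)%N) (fun k => lab (i * q + k)%N).
  move=> hij; have e : (i * q + (j - i) * q = j * q)%N by rewrite -mulnDl subnKC //; nlia.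
  have jN : (j * q <= N * q)%N by apply: leqq; nlia.
  apply: (billiard_sub hp); first by rewrite e.
  move=> k hk; apply: (bp_lab hp); apply: leq_trans jN; rewrite -e.
  by rewrite leq_add2l.
have shifth i j : (i <= j <= N)%N -> forall l, (l < j - i)%N ->
    hits S (fun k => lab (i * q + k)%N) (l * q) (l.+1 * q).
  move=> hij l hl; apply: hits_sub; rewrite -!mulnDl addnS; apply: hh; nlia.
have flat : (b - b')%:R <= 728 * A + 3.
  apply: (flat_count Bconv core_ne A1 retract q0 (F := F)
    (shiftp b' b ltac:(nlia)) (shifth b' b ltac:(nlia)) F0).
  - by move=> j hj; rewrite -mulnDl; apply: hmin; nlia.
  - by rewrite addn0.
  - by rewrite -mulnDl subnKC //; nlia.
have right : (N - s)%:R <= (b - s)%:R + 364 * A + 3.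
  apply: (growing_count Bconv core_ne A1 retract q0 (F := F)
    (shiftp s N ltac:(nlia)) (shifth s N ltac:(nlia)) F0).
  - by move=> j hj; rewrite -mulnDl; apply: hmin; nlia.
  - by rewrite addn0.
  - by nlia.
  - move=> j hj; rewrite -mulnDl ltNge; apply/negP => hle.
    have := maxb (s + j)%N; rewrite hle andbT => /(_ ltac:(nlia)); nlia.
have left : s%:R <= (s - b')%:R + 364 * A + 3.
  have hp1 := billiard_prefix hp (leqq _ _ hs).
  have hh1 := hits_grid_rev (N := s) (fun j hj => hh j (leq_trans hj hs)).
  apply: (growing_count Bconv core_ne A1 retract q0 (F := F) (billiard_rev hp1) hh1 F0).
  - by move=> j hj; rewrite -mulnBl; apply: hmin; nlia.
  - by rewrite subn0.
  - by nlia.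
  - move=> j hj; rewrite -mulnBl ltNge; apply/negP => hle.
    have := minb (s - j)%N; rewrite hle andbT => /(_ ltac:(nlia)); nlia.
move: flat right left; rewrite !natrB //; first by lra.
by nlia.
Qed.

End Fixed.

(** By induction on the number of obstacles, a run of c^N collisions meets all of
    N.+1 obstacles, and total_count limits the number of such runs in a row. *)
Lemma local_count (c : nat) (S : {set I}) K tau X W lab :
  1456 * A + 10 < c%:R ->
  (forall S' : {set I}, S' \subset S -> (core B S' !=set0)%classic) ->
  (forall S' : {set I}, S' \subset S -> forall x e, 0 <= e ->
    bodies_within B S' x e -> exists2 p, core B S' p & enorm (x - p) <= A * e) ->
  billiard B S K tau X W lab -> (K.+1 < c ^ #|S|)%N.
Proof.
move=> hc; move: {2}#|S| (erefl #|S|) => N.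
elim: N S K tau X W lab => [|N IH] S K tau X W lab hS ne rt hp.
  have := bp_lab hp (leq0n K).
  by rewrite (cards0_eq hS) inE.
rewrite hS ltnNge; apply/negP => hK.
have c2 : (1 < c)%N.
  by rewrite -(ltr_nat R); apply: lt_trans hc; have := A1; lra.
set q := (c ^ N)%N; have q0 : (0 < q)%N by rewrite expn_gt0 ltnW.
have hq : (c.-1 * q <= K)%N.
  by rewrite expnS -/q in hK; rewrite -subn1 mulnBl mul1n; nlia.
have hp1 := billiard_prefix hp hq.
have hh j : (j < c.-1)%N -> hits S lab (j * q) (j.+1 * q).
  move=> hj a aS; apply: contrapT => hno.
  have cD : #|S :\ a| = N by have := cardsD1 a S; rewrite aS hS; nlia.
  have jq : (j * q + q <= c.-1 * q)%N by rewrite addnC -mulSn leq_pmul2r.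
  have hp2 : billiard B (S :\ a) q (fun k => tau (j * q + k)%N)
      (fun k => X (j * q + k)%N) (fun k => W (j * q + k)%N)
      (fun k => lab (j * q + k)%N).
    apply: (billiard_sub hp1 jq) => k hk; rewrite !inE (bp_lab hp1) ?andbT; last first.
      by apply: leq_trans jq; rewrite leq_add2l.
    apply/eqP => e; apply: hno; exists (j * q + k)%N => //.
    by rewrite leq_addr mulSn addnC leq_add2r.
  have := IH (S :\ a) q _ _ _ _ cD _ _ hp2; rewrite cD -/q ltnNge leqnSn.
  have sub : S :\ a \subset S by apply: subD1set.
  move=> h; suff : false by [].
  by apply: h => S' hS'; [apply: ne|apply: rt]; apply: fintype.subset_trans hS' sub.
have := total_count (ne S (fintype.subxx _)) (rt S (fintype.subxx _)) q0 hp1 hh.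
have -> : c.-1%:R = c%:R - 1 :> R by rewrite -subn1 natrB // ltnW.
lra.
Qed.

End Total.

(** * Configurations of balls *)

Section Balls.
Context {R : realType} {n d : nat}.
Implicit Types (X Y : 'rV[R]_(n * d)) (i j : 'I_n).

Definition ball_of X i : 'rV[R]_d := row i (vec_mx X).

Definition conf (f : 'I_n -> 'rV[R]_d) : 'rV[R]_(n * d) :=
  mxvec (\matrix_i f i).

Lemma ball_conf f i : ball_of (conf f) i = f i.
Proof. by rewrite /ball_of mxvecK rowK. Qed.

Lemma ball_eq X Y : (forall i, ball_of X i = ball_of Y i) -> X = Y.
Proof.
move=> h; apply: (can_inj vec_mxK); apply/row_matrixP => i; exact: h.
Qed.

Lemma ball_ofD X Y i : ball_of (X + Y) i = ball_of X i + ball_of Y i.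
Proof. by rewrite /ball_of !linearD. Qed.

Lemma ball_ofB X Y i : ball_of (X - Y) i = ball_of X i - ball_of Y i.
Proof. by rewrite /ball_of !linearB. Qed.

Lemma ball_ofZ c X i : ball_of (c *: X) i = c *: ball_of X i.
Proof. by rewrite /ball_of !linearZ. Qed.

Lemma ball_of0 i : ball_of 0 i = 0.
Proof. by rewrite /ball_of !linear0. Qed.

(** The euclidean structure of the configuration space is the one for equal masses. *)
Lemma dotp_ball X Y : dotp X Y = \sum_i dotp (ball_of X i) (ball_of Y i).
Proof.
rewrite /dotp pair_big /= (reindex _ (curry_mxvec_bij n d)) /=.
apply: eq_bigr => -[i j] _ /=.
by rewrite /ball_of -{1}(vec_mxK X) -{1}(vec_mxK Y) !mxvecE !mxE.
Qed.

Lemma enorm_ball X i : enorm (ball_of X i) <= enorm X.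
Proof.
apply: le_enorm; rewrite ?enorm_ge0 // enorm_sqr dotp_ball (bigD1 i) //=.
by rewrite lerDl sumr_ge0 // => j _; exact: dotp_ge0.
Qed.

Lemma enorm_balls X D : 0 <= D -> (forall i, enorm (ball_of X i) <= D) ->
  enorm X <= Num.sqrt n%:R * D.
Proof.
move=> D0 h; apply: le_enorm; first by rewrite mulr_ge0 ?sqrtr_ge0.
rewrite dotp_ball exprMn sqr_sqrtr ?ler0n //.
apply: (@le_trans _ _ (\sum_(i < n) D ^+ 2)); last first.
  by rewrite sumr_const card_ord mulr_natl.
apply: ler_sum => i _; rewrite -enorm_sqr.
by rewrite ler_pXn2r // nnegrE enorm_ge0.
Qed.

Definition contact (r : R) (p : 'I_n * 'I_n) : set 'rV[R]_(n * d) :=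
  [set X | enorm (ball_of X p.1 - ball_of X p.2) <= 2 * r]%classic.

Lemma contact_convex r p : convex_body (contact r p).
Proof.
move=> x y c /andP[c0 c1] hx hy; rewrite /contact /= in hx hy *.
rewrite !(ball_ofB, ball_ofD, ball_ofZ).
set a := ball_of x p.1; set b := ball_of x p.2.
rewrite -/a -/b in hx.
have -> : a + c *: (ball_of y p.1 - a) - (b + c *: (ball_of y p.2 - b)) =
  (1 - c) *: (a - b) + c *: (ball_of y p.1 - ball_of y p.2).
  by apply/rowP => i; rewrite !mxE; ring.
apply: le_trans (enormD _ _) _; rewrite !enormZ !ger0_norm ?subr_ge0 //.
have : 0 <= 1 - c by rewrite subr_ge0.
move=> /ler_wpM2l/(_ _ _ hx); have := ler_wpM2l c0 hy; lra.
Qed.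

Definition edge (S : {set 'I_n * 'I_n}) : rel 'I_n :=
  fun i j => ((i, j) \in S) || ((j, i) \in S).

Lemma edge_sym S : symmetric (edge S).
Proof. by move=> i j; rewrite /edge orbC. Qed.

Lemma edge_connect_sym S : connect_sym (edge S).
Proof. exact: sym_connect_sym (@edge_sym S). Qed.

(** A chain of at most n contacts joins any two balls of a component. *)
Lemma enorm_connect (S : {set 'I_n * 'I_n}) X D i j : 0 <= D ->
  (forall p, p \in S -> enorm (ball_of X p.1 - ball_of X p.2) <= D) ->
  connect (edge S) i j -> enorm (ball_of X i - ball_of X j) <= n%:R * D.
Proof.
move=> D0 h /connectP[s]; case/shortenP => s' hs' us' _ ->.
have hsz : (size s' <= n)%N.
  have := max_card (mem (i :: s')); rewrite (elimT card_uniqP us') card_ord.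
  exact: ltnW.
apply: (@le_trans _ _ ((size s')%:R * D)); last by rewrite ler_wpM2r // ler_nat.
elim: s' i hs' {us' hsz} => [|k s' IH] i /=; first by rewrite subrr enorm0 mul0r.
move=> /andP[e /IH {}IH]; apply: le_trans (enorm_tri (ball_of X k) _ _) _.
rewrite -natr1 mulrDl mul1r addrC lerD //.
by case/orP: e => /h //=; rewrite enormB.
Qed.

Lemma contact_core0 r (S : {set 'I_n * 'I_n}) : 0 <= r ->
  core (contact r) S 0.
Proof.
by move=> r0 p _; rewrite /contact /= !ball_of0 subrr enorm0 mulr_ge0.
Qed.

Lemma within_contact r (S : {set 'I_n * 'I_n}) X e p :
  bodies_within (contact r) S X e -> p \in S ->
  enorm (ball_of X p.1 - ball_of X p.2) <= 2 * r + 2 * e.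
Proof.
move=> h pS; have [Y hY hXY] := h p pS; rewrite /contact /= in hY.
have -> : ball_of X p.1 - ball_of X p.2 =
   (ball_of Y p.1 - ball_of Y p.2) + (ball_of (X - Y) p.1 - ball_of (X - Y) p.2).
  by rewrite !ball_ofB; apply/rowP => i; rewrite !mxE; ring.
apply: le_trans (enormD _ _) _; apply: lerD => //.
apply: le_trans (enormD _ _) _; rewrite enormN.
by have := enorm_ball (X - Y) p.1; have := enorm_ball (X - Y) p.2; lra.
Qed.

(** How many times farther than from the single obstacles a configuration can be from all
    of them together. *)
Definition regularity : R := 2 * n%:R * Num.sqrt n%:R.

(** Each component is shrunk towards one of its balls, by the factor that brings a distance
    of 2 r + 2 e down to 2 r. *)
Lemma contact_retract r (S : {set 'I_n * 'I_n}) X e : 0 < r -> 0 <= e ->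
  bodies_within (contact r) S X e ->
  exists2 P, core (contact r) S P & enorm (X - P) <= regularity * e.
Proof.
move=> r0 e0 hw.
set s := 2 * r + 2 * e; have s0 : 0 < s by rewrite /s; lra.
pose rt i := fingraph.root (edge S) i.
have hS p : p \in S -> enorm (ball_of X p.1 - ball_of X p.2) <= s.
  exact: within_contact.
exists (conf (fun i => ball_of X (rt i) +
    (2 * r / s) *: (ball_of X i - ball_of X (rt i)))).
  move=> p pS; rewrite /contact /= !ball_conf.
  have -> : rt p.1 = rt p.2.
    apply/eqP; rewrite root_connect; last exact: edge_connect_sym.
    by apply: connect1; rewrite /edge -surjective_pairing pS.
  have -> : forall a b c : 'rV[R]_d,
    a + (2 * r / s) *: (b - a) - (a + (2 * r / s) *: (c - a)) = (2 * r / s) *: (b - c).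
    by move=> a b c; apply/rowP => i; rewrite !mxE; ring.
  rewrite enormZ ger0_norm; last by rewrite divr_ge0 ?mulr_ge0 // ltW.
  apply: (@le_trans _ _ (2 * r / s * s)); last by rewrite divfK // gt_eqF.
  by apply: ler_wpM2l; [rewrite divr_ge0 ?mulr_ge0 // ltW|exact: hS].
have D0 : 0 <= 2 * e * n%:R by rewrite mulr_ge0 ?mulr_ge0.
have -> : regularity * e = Num.sqrt n%:R * (2 * e * n%:R) by rewrite /regularity; ring.
apply: enorm_balls => // i; rewrite ball_ofB ball_conf.
have -> : ball_of X i - (ball_of X (rt i) +
    (2 * r / s) *: (ball_of X i - ball_of X (rt i))) =
    (2 * e / s) *: (ball_of X i - ball_of X (rt i)).
  have -> : 2 * e / s = 1 - 2 * r / s by rewrite /s; field; rewrite gt_eqF.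
  by apply/rowP => k; rewrite !mxE; ring.
rewrite enormZ ger0_norm; last by rewrite divr_ge0 ?mulr_ge0 // ltW.
apply: (@le_trans _ _ (2 * e / s * (n%:R * s))); last first.
  by rewrite le_eqVlt; apply/orP; left; apply/eqP; field; rewrite gt_eqF.
apply: ler_wpM2l; first by rewrite divr_ge0 ?mulr_ge0 // ltW.
by apply: enorm_connect hS _; [exact: ltW|exact: connect_root].
Qed.

End Balls.

(** * Packing *)

Section Packing.
Context {R : realType} {d : nat}.
Hypothesis d0 : (0 < d)%N.

(** Rounding the coordinates to multiples of 1/d separates the points. *)
Lemma packing_crude (T : finType) (z : T -> 'rV[R]_d) (Z : nat) :
  (forall t t', t != t' -> 2 <= enorm (z t - z t')) ->
  (forall t, enorm (z t) <= Z%:R) ->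
  (#|T| <= (2 * Z * d).+1 ^ d)%N.
Proof.
move=> sep bd.
have dR : 0 < d%:R :> R by rewrite ltr0n.
have coord t i : 0 <= z t ord0 i + Z%:R <= 2 * Z%:R.
  suff : `|z t ord0 i| <= Z%:R by rewrite ler_norml => /andP[? ?]; lra.
  apply: le_trans (bd t); rewrite -sqrtr_sqr ler_sqrt ?dotp_ge0 //.
  by rewrite /dotp (bigD1 i) //= -expr2 lerDl sumr_ge0 // => j _; rewrite -expr2 sqr_ge0.
pose cell t i := Num.truncn ((z t ord0 i + Z%:R) * d%:R).
have cellP t i : ((cell t i)%:R <= (z t ord0 i + Z%:R) * d%:R < (cell t i).+1%:R).
  by apply: truncn_itv; case/andP: (coord t i) => ? _; rewrite mulr_ge0 ?ler0n.
have cell_lt t i : (cell t i < (2 * Z * d).+1)%N.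
  rewrite ltnS -(ler_nat R) !natrM; case/andP: (cellP t i) => h _.
  by apply: (le_trans h); rewrite ler_wpM2r // ?ler0n //; case/andP: (coord t i).
pose g t := [ffun i : 'I_d => Ordinal (cell_lt t i)].
suff gi : injective g.
  by have := leq_card g gi; rewrite card_ffun !card_ord.
move=> t t' e; apply/eqP; apply: contraT => /sep h.
suff : enorm (z t - z t') <= 1 by lra.
apply: le_enorm => //; rewrite /dotp expr1n.
apply: (@le_trans _ _ (\sum_(i < d) (d%:R^-1 : R))); last first.
  by rewrite sumr_const card_ord -[_^-1 *+ d]mulr_natl mulfV // gt_eqF.
apply: ler_sum => i _; rewrite !mxE -expr2.
have ec : cell t i = cell t' i.
  by have := congr1 (fun f : {ffun _ -> _} => val (f i)) e; rewrite !ffunE.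
have := cellP t i; have := cellP t' i; rewrite -ec -natr1.
set a := z t ord0 i; set b := z t' ord0 i => /andP[h1 h2] /andP[h3 h4].
have h5 : `|(a - b) * d%:R| <= 1 by rewrite ler_norml; lra.
rewrite -real_normK ?num_real //; rewrite normrM (ger0_norm (ler0n R d)) in h5.
have h6 : `|a - b| <= d%:R^-1 by rewrite -[X in _ <= X]mul1r ler_pdivlMr.
have h7 : d%:R^-1 <= 1 :> R by rewrite invf_le1 // ler1n.
rewrite expr2; apply: (@le_trans _ _ (d%:R^-1 * 1)); last by rewrite mulr1.
by apply: ler_pM => //; apply: le_trans h6 h7.
Qed.

(** Copies of the packing of level k are centred at the points of the original one,
    enlarged 5^k times.  For large k the constants of packing_crude become negligible. *)
Lemma packing_power (T : finType) (y : T -> 'rV[R]_d) (k : nat) :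
  (forall t t', t != t' -> 2 <= enorm (y t - y t')) ->
  (forall t, enorm (y t) <= 4) ->
  exists (T' : finType) (z : T' -> 'rV[R]_d),
    [/\ #|T'| = (#|T| ^ k)%N,
       forall t t', t != t' -> 2 <= enorm (z t - z t') &
       forall t, enorm (z t) <= (5 ^ k)%:R - 1].
Proof.
move=> sep bd; elim: k => [|k [T' [z [hc hs hb]]]].
  exists unit, (fun=> 0); split=> [|[] []//|_]; first by rewrite card_unit.
  by rewrite enorm0 subrr.
exists (T' * T)%type, (fun s => z s.1 + (5 ^ k)%:R *: y s.2); split.
- by rewrite card_prod hc expnSr.
- move=> [t s] [t' s'] /= ne.
  have [e|nes] := eqVneq s s'.
    rewrite e; have -> : z t + (5 ^ k)%:R *: y s' - (z t' + (5 ^ k)%:R *: y s') = z t - z t'.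
      by apply/rowP => i; rewrite !mxE; ring.
    by apply: hs; apply: contraNneq ne => ->; rewrite e.
  have -> : z t + (5 ^ k)%:R *: y s - (z t' + (5 ^ k)%:R *: y s') =
      (5 ^ k)%:R *: (y s - y s') - (z t' - z t).
    by apply/rowP => i; rewrite !mxE; ring.
  apply: le_trans (enorm_geB _ _); rewrite enormZ ger0_norm ?ler0n //.
  have h1 := ler_wpM2l (ler0n R (5 ^ k)) (sep _ _ nes).
  have h2 := enormD (z t') (- z t); rewrite enormN in h2.
  by have := hb t; have := hb t'; lra.
- move=> [t s] /=; apply: le_trans (enormD _ _) _.
  rewrite enormZ ger0_norm ?ler0n // expnS natrM.
  by have := ler_wpM2l (ler0n R (5 ^ k)) (bd s); have := hb t; lra.
Qed.

(** Bernoulli: a power of a.+1 outgrows any multiple of the same power of a. *)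
Lemma power_bound (N C a : nat) : (0 < a)%N ->
  (forall k, (N ^ k <= C * a ^ k)%N) -> (N <= a)%N.
Proof.
move=> a0 h; rewrite leqNgt; apply/negP => aN.
have bern k : (a ^ k * (a + k) <= a * a.+1 ^ k)%N.
  elim: k => [|k IH]; first by rewrite !expn0 addn0 mul1n muln1.
  have h1 : (a.+1 * (a ^ k * (a + k)) <= a.+1 * (a * a.+1 ^ k))%N.
    by rewrite leq_mul2l IH orbT.
  by rewrite !expnS; nia.
have := bern (C * a)%N; have hk := h (C * a)%N.
have h2 : (a.+1 ^ (C * a) <= N ^ (C * a))%N.
  by case: (posnP (C * a)%N) => [-> //|k0]; rewrite leq_exp2r.
have p0 : (0 < a ^ (C * a))%N by rewrite expn_gt0 a0.
nia.
Qed.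

Lemma packing_unit (T : finType) (y : T -> 'rV[R]_d) :
  (forall t t', t != t' -> 2 <= enorm (y t - y t')) ->
  (forall t, enorm (y t) <= 4) -> (#|T| <= 5 ^ d)%N.
Proof.
move=> sep bd; apply: (@power_bound _ ((3 * d) ^ d)); first by rewrite expn_gt0.
move=> k; have [T' [z [hc hs hb]]] := packing_power k sep bd.
have -> : ((3 * d) ^ d * (5 ^ d) ^ k = (3 * d * 5 ^ k) ^ d)%N.
  by rewrite [RHS]expnMn -!expnM [(d * k)%N]mulnC.
rewrite -hc.
apply: leq_trans (packing_crude (Z := (5 ^ k)%N) hs _) _.
  by move=> t; apply: le_trans (hb t) _; lra.
case: d d0 => // d' _; rewrite leq_exp2r //.
have : (0 < 5 ^ k)%N by rewrite expn_gt0.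
nia.
Qed.

(** The bound is the quotient of the volumes of balls of radii 5 r and r; the proof
    replaces volumes by iterated packings. *)
Lemma packing (T : finType) (y : T -> 'rV[R]_d) (r : R) : 0 < r ->
  (forall t t', t != t' -> 2 * r <= enorm (y t - y t')) ->
  (forall t, enorm (y t) <= 4 * r) -> (#|T| <= 5 ^ d)%N.
Proof.
move=> r0 sep bd; apply: (@packing_unit T (fun t => r^-1 *: y t)) => [t t' ne|t].
  rewrite -scalerBr enormZ ger0_norm ?invr_ge0 ?(ltW r0) // mulrC ler_pdivlMr //.
  exact: sep.
by rewrite enormZ ger0_norm ?invr_ge0 ?(ltW r0) // mulrC ler_pdivrMr.
Qed.

End Packing.

Section Degree.
Context {R : realType} {n d : nat}.
Hypothesis d0 : (0 < d)%N.

(** A ball and its neighbours form a packing; summing over the balls counts each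
    pair twice. *)
Lemma near_pairs (S : {set 'I_n * 'I_n}) (X : 'rV[R]_(n * d)) (r : R) : 0 < r ->
  (forall i j, i != j -> 2 * r <= enorm (ball_of X i - ball_of X j)) ->
  (forall p, p \in S -> (p.1 < p.2)%N) ->
  (forall p, p \in S -> enorm (ball_of X p.1 - ball_of X p.2) <= 4 * r) ->
  (2 * #|S| <= n * 5 ^ d)%N.
Proof.
move=> r0 hard ord near.
pose sw (p : 'I_n * 'I_n) := (p.2, p.1).
have sw_inj : injective sw by move=> [a b] [a' b'] [-> ->].
pose E := S :|: sw @: S.
have cE : #|E| = (2 * #|S|)%N.
  rewrite cardsU card_imset // (_ : S :&: _ = finset.set0) ?cards0.
    by rewrite subn0 addnn mul2n.
  apply/setP => p; rewrite !inE; apply/negbTE/negP => /andP[pS /imsetP[p' p'S e]].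
  by have := ord _ pS; have := ord _ p'S; rewrite e /=; lia.
rewrite -cE.
have eE : #|E| = (\sum_i #|[set j | (i, j) \in E]|)%N.
  rewrite -sum1_card (eq_bigl (fun p => (p.1, p.2) \in E)); last by case.
  rewrite -(pair_big_dep predT (fun i j => (i, j) \in E) (fun _ _ => 1%N)) /=.
  by apply: eq_bigr => i _; rewrite -sum1_card; apply: eq_bigl => j; rewrite inE.
rewrite eE; apply: (@leq_trans (\sum_(i < n) 5 ^ d)%N); last first.
  by rewrite sum_nat_const card_ord.
apply: leq_sum => i _; set A := [set j | _].
rewrite -card_sig.
apply: (@packing R d d0 _ (fun t => ball_of X (val t) - ball_of X i) r r0).
  move=> t t' ne; rewrite opprB addrA subrK; apply: hard.
  by apply: contraNneq ne => e; apply/eqP/val_inj.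
case=> j hj /=; have : j \in A by exact: hj.
rewrite !inE => /orP[h|/imsetP[p pS [e1 e2]]].
  by rewrite enormB; apply: (near (i, j)).
by rewrite e1 e2; apply: near.
Qed.

End Degree.

(** * Counting stretches seen from an apex *)

Section Apex.
Context {R : realType} {m : nat} {I : finType}.
Context {B : I -> set 'rV[R]_m} {S : {set I}} {A : R} {p : 'rV[R]_m}.
Hypothesis Bconv : forall i, convex_body (B i).
Hypothesis A1 : 1 <= A.
Hypothesis pc : core B S p.

(** The lengths of the stretches are at least of the order of the initial distance over A,
    until the path has travelled that distance; from then on the aperture is at most 2,
    and each stretch consumes at least 1 / A of it. *)
Lemma apex_forward N q tau X W lab (Sg : nat -> {set I}) :
  (0 < q)%N -> billiard B S (N * q) tau X W lab ->
  (forall j, (j < N)%N -> hits (Sg j) lab (j * q) (j.+1 * q)) ->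
  (forall j e, (j < N)%N -> 0 <= e -> bodies_within B (Sg j) (X (j * q)%N) e ->
    enorm (X (j * q)%N - p) <= A * e) ->
  0 < enorm (X 0%N - p) -> 0 <= radial X W p 0 -> N%:R <= 4 * A + 2.
Proof.
move=> q0 hp hh hf h0 r0; have A0 : 0 <= A by apply: le_trans ler01 A1.
pose t j := tau (j * q)%N; pose h j := enorm (X (j * q)%N - p).
have tz : tau 0%N = t 0%N by rewrite /t mul0n.
have leqq i j : (i <= j)%N -> (i * q <= j * q)%N by move=> ?; rewrite leq_pmul2r.
have ltqq i j : (i < j)%N -> (i * q < j * q)%N by move=> ?; rewrite ltn_pmul2r.
set H := enorm (X 0%N - p) in h0.
have tm i j : (i <= j <= N)%N -> t i <= t j.
  by move=> /andP[? ?]; apply: (tau_mono hp); rewrite !leqq.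
have rj j : (j < N)%N -> t j - t 0%N <= radial X W p (j * q).
  move=> hj; have jK := ltqq _ _ hj.
  by have := radial_mono hp pc (i := 0) (j := (j * q)%N) jK; rewrite -/(t j) tz; lra.
have hr j : (j < N)%N -> radial X W p (j * q) <= h j.
  by move=> hj; apply: (radial_le hp); apply: ltqq.
have lipj j : (j <= N)%N -> h j <= H + (t j - t 0%N) /\ H - (t j - t 0%N) <= h j.
  move=> hj; have jK := leqq _ _ hj.
  have := X_lip hp (i := 0) (j := (j * q)%N) jK; rewrite -/(t j) tz => hX.
  have a1 := enorm_tri (X 0%N) (X (j * q)%N) p; rewrite -/H -/(h j) in a1.
  have a2 := enorm_tri (X (j * q)%N) (X 0%N) p.
  rewrite (enormB (X 0%N) (X (j * q)%N)) -/H -/(h j) in a2.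
  by split; lra.
have hhalf j : (j < N)%N -> H / 2 <= h j.
  by move=> hj; have := rj j hj; have := hr j hj; have [_] := lipj j (ltnW hj); lra.
have tc j : (j <= N)%N -> j%:R * (H / 2) <= A * (t j - t 0%N).
  move=> hj; have := time_steps q0 hp hh hf (F := H / 2) (j0 := 0) (j1 := j) hj
    (fun i hi => hhalf i (leq_trans hi hj)).
  by rewrite subr0.
have tc' j : (j <= N)%N -> t j - t 0%N < H -> j%:R <= 2 * A.
  move=> hj h4; have H2 : 0 < H / 2 by lra.
  rewrite -(ler_pM2r H2); apply: le_trans (tc j hj) _.
  by have := ler_wpM2l A0 (ltW h4); lra.
have [hN|hN] := ltP (t N - t 0%N) H.
  by have := tc' N (leqnn _) hN; lra.
have ex0 : exists j, (j <= N)%N && (H <= t j - t 0%N).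
  by exists N; rewrite leqnn.
case: (ex_minnP ex0) => j0 /andP[jN hj0] minj.
have hj0' : j0%:R <= 2 * A + 1.
  case: j0 {ex0} jN hj0 minj => [|j0] jN hj0 minj; first by lra.
  have hlt : t j0 - t 0%N < H.
    rewrite ltNge; apply/negP => hge.
    by have := minj j0; rewrite hge andbT (ltnW jN) ltnn => /(_ isT).
  by have := tc' j0 (ltnW jN) hlt; rewrite -[j0.+1%:R]natr1; lra.
have [hs2|hs2] := leqP N j0.+1.
  by move: hs2; rewrite -(ler_nat R) -[j0.+1%:R]natr1; lra.
have rp : 0 < radial X W p (j0 * q) by apply: lt_le_trans (rj j0 (ltnW hs2)); lra.
have ap : aperture X W p (j0 * q) <= 2.
  rewrite ler_pdivrMr //; have [h1 _] := lipj j0 jN; have h2 := rj j0 (ltnW hs2).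
  by have := impact_le hp (p := p) (ltqq _ _ (ltnW hs2)); rewrite -/(h j0); lra.
have hN1 : (N.-1 < N)%N by nlia.
have := forward_steps Bconv A1 q0 hp hh hf (j0 := j0) (j1 := N.-1)
   (s := 1) pc ltac:(nlia) hN1 rp ap.
have -> : N.-1%:R = N%:R - 1 :> R by rewrite -subn1 natrB //; nlia.
rewrite mulr1 => HH.
suff : N%:R - 1 - j0%:R <= A * 2 by lra.
by apply: HH => j hj; rewrite mul1r; apply: hr; nlia.
Qed.

Lemma apex_far N q tau X W lab (Sg : nat -> {set I}) :
  (0 < q)%N -> billiard B S (N * q) tau X W lab ->
  (forall j, (j < N)%N -> hits (Sg j) lab (j * q) (j.+1 * q)) ->
  (forall j i e, (j < N)%N -> (j <= i <= j.+1)%N -> 0 <= e ->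
    bodies_within B (Sg j) (X (i * q)%N) e -> enorm (X (i * q)%N - p) <= A * e) ->
  (forall j, (j <= N)%N -> 0 < enorm (X (j * q)%N - p)) -> N%:R <= 8 * A + 5.
Proof.
move=> q0 hp hh hf h0; have A0 : 0 <= A by apply: le_trans ler01 A1.
have leqq i j : (i <= j)%N -> (i * q <= j * q)%N by move=> ?; rewrite leq_pmul2r.
have ltqq i j : (i < j)%N -> (i * q < j * q)%N by move=> ?; rewrite ltn_pmul2r.
(* beyond a grid point that moves away from the apex *)
have right s : (s <= N)%N -> 0 <= radial X W p (s * q) -> (N - s)%:R <= 4 * A + 2.
  move=> sN hs; have e : (s * q + (N - s) * q = N * q)%N by rewrite -mulnDl subnKC.
  have hp1 : billiard B S ((N - s) * q) (fun k => tau (s * q + k)%N)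
      (fun k => X (s * q + k)%N) (fun k => W (s * q + k)%N) (fun k => lab (s * q + k)%N).
    apply: (billiard_sub hp); first by rewrite e.
    by move=> k hk; apply: (bp_lab hp); rewrite -e leq_add2l.
  apply: (apex_forward (Sg := fun j => Sg (s + j)%N) q0 hp1).
  - by move=> j hj; apply: hits_sub; rewrite -!mulnDl addnS; apply: hh; nlia.
  - by move=> j e' hj he; rewrite -mulnDl => hw; apply: (hf (s + j)%N) => //; nlia.
  - by rewrite addn0; apply: h0.
  - by rewrite /radial !addn0.
(* before a grid point that moves towards the apex *)
have left s : (s <= N)%N -> (s * q < N * q)%N -> radial X W p (s * q) < 0 ->
    s%:R <= 4 * A + 2.
  move=> sN sK hs; case: (posnP s) => [->|sp]; first by lra.
  have hp1 := billiard_rev (billiard_prefix hp (leqq _ _ sN)).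
  apply: (apex_forward (Sg := fun j => Sg (s - j.+1)%N) q0 hp1).
  - move=> j hj; have := hits_rev (K := (s * q)%N) (hh (s - j.+1)%N ltac:(nlia)).
    rewrite leq_mul2r; have -> : ((s - j.+1).+1 <= s)%N by nlia.
    rewrite orbT -!mulnBl => /(_ isT).
    have -> : (s - (s - j.+1).+1 = j)%N by nlia.
    by have -> : (s - (s - j.+1) = j.+1)%N by nlia.
  - by move=> j e' hj he; rewrite -mulnBl => hw; apply: (hf (s - j.+1)%N) => //; nlia.
  - by rewrite subn0; apply: h0.
  - have sq : (0 < s * q)%N by rewrite muln_gt0 sp.
    rewrite /radial subn0 dotpNr oppr_ge0.
    have k1 : (s * q - 1).+1 = (s * q)%N by nlia.
    have k1K : ((s * q - 1).+1 < N * q)%N by rewrite k1.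
    have := radial_step hp pc k1K; rewrite -(radial_flight hp (p := p) (ltnW k1K)) k1.
    by move=> /le_trans; apply; exact: ltW.
have [hN|hN] := leqP N 1.
  by move: hN; rewrite -(ler_nat R); lra.
have [ex0|ex0] := pselect (exists j, (j < N)%N && (0 <= radial X W p (j * q))).
  case: (ex_minnP ex0) => s /andP[sN rs] mins.
  have := right s (ltnW sN) rs; rewrite natrB; last exact: ltnW.
  case: s sN {rs} mins => [|s] sN mins; first by lra.
  have := left s (ltnW (ltnW sN)) (ltqq _ _ (ltnW sN)).
  rewrite -[s.+1%:R]natr1 => hl hr; suff : s%:R <= 4 * A + 2 by lra.
  apply: hl; rewrite ltNge; apply/negP => hge.
  by have := mins s; rewrite hge (ltnW sN) ltnn => /(_ isT).
have hN1 : (N.-1 < N)%N by nlia.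
have := left N.-1 (ltnW hN1) (ltqq _ _ hN1).
have -> : N.-1%:R = N%:R - 1 :> R by rewrite -subn1 natrB //; nlia.
move=> hl; suff : N%:R - 1 <= 4 * A + 2 by lra.
apply: hl; rewrite ltNge; apply/negP => hge.
by apply: ex0; exists N.-1; rewrite hN1.
Qed.

Lemma window_time K tau X W lab r (L Z : nat) i :
  billiard B S K tau X W lab ->
  (forall i j, (i <= j <= K)%N -> tau j - tau i <= r -> (j - i < L)%N) ->
  (i + Z * L <= K)%N -> Z%:R * r <= tau (i + Z * L)%N - tau i.
Proof.
move=> hp hw; elim: Z => [|Z IH] hK; first by rewrite mul0r mul0n addn0 subrr.
have hK' : (i + Z * L <= K)%N by apply: leq_trans hK; rewrite leq_add2l leq_mul2r leqnSn orbT.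
have := IH hK'; rewrite -[Z.+1%:R]natr1.
suff : r < tau (i + Z.+1 * L)%N - tau (i + Z * L)%N by lra.
rewrite ltNge; apply/negP => hle.
have e : (i + Z.+1 * L = i + Z * L + L)%N by rewrite mulSn; nlia.
have hi : (i + Z * L <= i + Z.+1 * L <= K)%N by rewrite hK andbT e leq_addr.
by have := hw _ _ hi hle; rewrite e addKn ltnn.
Qed.

(** The stretches whose start is within H of the apex lie in a time span 2 H, because
    the radial speed increases at least at unit rate from -H to H; the time span is
    covered by windows of length r, each with fewer than L collisions. *)
Lemma apex_total N q tau X W lab (Sg : nat -> {set I}) (H r : R) (L Z : nat) :
  (0 < q)%N -> (L <= q)%N -> billiard B S (N * q) tau X W lab ->
  (forall j, (j < N)%N -> hits (Sg j) lab (j * q) (j.+1 * q)) ->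
  0 < H -> 0 < r ->
  (forall j i e, (j < N)%N -> (j <= i <= j.+1)%N -> 0 <= e ->
    bodies_within B (Sg j) (X (i * q)%N) e -> H < enorm (X (i * q)%N - p) ->
    enorm (X (i * q)%N - p) <= A * e) ->
  (forall i j, (i <= j <= N * q)%N -> tau j - tau i <= r -> (j - i < L)%N) ->
  2 * H < Z%:R * r ->
  N%:R <= 16 * A + 12 + Z%:R.
Proof.
move=> q0 Lq hp hh H0 r0 hf hw hZ; have A0 : 0 <= A by apply: le_trans ler01 A1.
have leqq i j : (i <= j)%N -> (i * q <= j * q)%N by move=> ?; rewrite leq_pmul2r.
have ltqq i j : (i < j)%N -> (i * q < j * q)%N by move=> ?; rewrite ltn_pmul2r.
pose h j := enorm (X (j * q)%N - p).
have far i j : (i <= j <= N)%N -> (forall l, (i <= l <= j)%N -> H < h l) ->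
    (j - i)%:R <= 8 * A + 5.
  move=> hij hl; have e : (i * q + (j - i) * q = j * q)%N by rewrite -mulnDl subnKC //; nlia.
  have jN : (j * q <= N * q)%N by apply: leqq; nlia.
  have hp1 : billiard B S ((j - i) * q) (fun k => tau (i * q + k)%N)
      (fun k => X (i * q + k)%N) (fun k => W (i * q + k)%N) (fun k => lab (i * q + k)%N).
    apply: (billiard_sub hp); first by rewrite e.
    by move=> k hk; apply: (bp_lab hp); apply: leq_trans jN; rewrite -e leq_add2l.
  apply: (apex_far (Sg := fun l => Sg (i + l)%N) q0 hp1).
  - by move=> l ?; apply: hits_sub; rewrite -!mulnDl addnS; apply: hh; nlia.
  - move=> l k e' ? ? he; rewrite -mulnDl => hb.
    by apply: (hf (i + l)%N) => //; [nlia|nlia|apply: hl; nlia].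
  - by move=> l ?; rewrite -mulnDl; apply: lt_trans H0 (hl _ _); nlia.
have [ex0|nex] := pselect (exists j, (j <= N)%N && (h j <= H)); last first.
  have := far 0%N N (leqnn N); rewrite subn0 => hfar.
  suff : N%:R <= 8 * A + 5 by have := ler0n R Z; lra.
  apply: hfar => l /andP[_ hl]; rewrite ltNge; apply/negP => hle.
  by apply: nex; exists l; rewrite hl.
have bd j : (j <= N)%N && (h j <= H) -> (j <= N)%N by case/andP.
case: (ex_minnP ex0) => a /andP[aN ha] mina.
case: (ex_maxnP ex0 bd) => b /andP[bN hb] maxb.
have ab : (a <= b)%N by apply: mina; rewrite bN hb.
have la : a%:R <= 8 * A + 6.
  case: a {ha ab} aN mina => [|a] aN mina; first by lra.
  have := far 0%N a ltac:(nlia); rewrite subn0 -[a.+1%:R]natr1 => hfar.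
  suff : a%:R <= 8 * A + 5 by lra.
  apply: hfar => l hl; rewrite ltNge; apply/negP => hle.
  by have := mina l; rewrite hle andbT => /(_ ltac:(nlia)); nlia.
have lb : N%:R - b%:R <= 8 * A + 6.
  have [e|ne] := eqVneq b N; first by rewrite e subrr; lra.
  have bN' : (b < N)%N by nlia.
  have := far b.+1 N ltac:(nlia); rewrite natrB // -[b.+1%:R]natr1 => hfar.
  suff : N%:R - (b%:R + 1) <= 8 * A + 5 by lra.
  apply: hfar => l hl; rewrite ltNge; apply/negP => hle.
  by have := maxb l; rewrite hle andbT => /(_ ltac:(nlia)); nlia.
(* the near stretch is short in time *)
suff : b%:R - a%:R <= Z%:R :> R by lra.
have [e|ne] := eqVneq a b; first by rewrite e subrr ler0n.
have ab' : (a < b)%N by nlia.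
have tab : tau (b * q)%N - tau (a * q)%N <= 2 * H.
  have abq := ltqq _ _ ab'; have bNq := leqq _ _ bN.
  have k1 : (b * q - 1).+1 = (b * q)%N by nlia.
  have k1K : (b * q - 1 < N * q)%N by rewrite k1.
  have h1 := radial_mono hp pc (i := (a * q)%N) (j := (b * q - 1)%N) ltac:(nlia).
  have h2 := radial_flight hp (p := p) k1K; rewrite k1 in h2.
  have h3 := cauchy_schwarz (X (b * q)%N - p) (W (b * q - 1)%N).
  rewrite (unit_enorm hp k1K) mulr1 -/(h b) in h3.
  have h4 := radial_ge hp (p := p) (k := (a * q)%N) (leq_trans abq bNq).
  rewrite -/(h a) in h4; lra.
rewrite -natrB // ler_nat leqNgt; apply/negP => hgt.
have hZL : (a * q + Z * L <= b * q)%N.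
  have e : (b * q = a * q + (b - a) * q)%N by rewrite -mulnDl subnKC.
  by rewrite e leq_add2l; apply: leq_mul => //; exact: ltnW.
have hK : (a * q + Z * L <= N * q)%N := leq_trans hZL (leqq _ _ bN).
have h1 := window_time hp hw hK.
have h2 := tau_mono hp (i := (a * q + Z * L)%N) (j := (b * q)%N)
  (introT andP (conj hZL (leqq _ _ bN))).
have := lt_le_trans hZ h1; lra.
Qed.

End Apex.

(** * The frame of the centroids *)

Section Centroid.
Context {R : realType} {n d : nat}.
Implicit Types (X Y : 'rV[R]_(n * d)) (i j : 'I_n).

Lemma enorm_sum (I : finType) (P : pred I) (F : I -> 'rV[R]_d) (D : R) :
  (forall a, P a -> enorm (F a) <= D) ->
  enorm (\sum_(a | P a) F a) <= D *+ #|P|.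
Proof.
move=> h; rewrite -sumr_const; elim/big_ind2 : _ => //.
- by rewrite enorm0.
- by move=> a x b y ha hb; apply: le_trans (enormD _ _) (lerD ha hb).
Qed.

Context (S : {set 'I_n * 'I_n}).
Let e := edge S.

(** Each ball is replaced by the centroid of its component. *)
Definition centroid X : 'rV[R]_(n * d) :=
  conf (fun i => (#|connect e i|%:R)^-1 *: \sum_(j | connect e i j) ball_of X j).

(** The configurations that a contact cannot feel: all balls of a component are moved by
    the same vector. *)
Definition comoving X : Prop :=
  forall p, p \in S -> ball_of X p.1 = ball_of X p.2.

Lemma centroidD X Y : centroid (X + Y) = centroid X + centroid Y.
Proof.
apply: ball_eq => i; rewrite ball_ofD !ball_conf -scalerDr -big_split.
by congr (_ *: _); apply: eq_bigr => j _; rewrite ball_ofD.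
Qed.

Lemma centroidZ c X : centroid (c *: X) = c *: centroid X.
Proof.
apply: ball_eq => i; rewrite ball_ofZ !ball_conf scalerA mulrC -scalerA; congr (_ *: _).
by rewrite scaler_sumr; apply: eq_bigr => j _; rewrite ball_ofZ.
Qed.

Lemma centroidB X Y : centroid (X - Y) = centroid X - centroid Y.
Proof. by rewrite -scaleN1r centroidD centroidZ scaleN1r. Qed.

Lemma centroid_connect X i j : connect e i j ->
  ball_of (centroid X) i = ball_of (centroid X) j.
Proof.
move=> h; have hs k : connect e i k = connect e j k.
  exact: (same_connect (@edge_connect_sym _ S) h).
by rewrite !ball_conf (eq_card hs) (eq_bigl _ _ hs).
Qed.

Lemma centroid_comoving X : comoving (centroid X).
Proof.
move=> p pS; apply: centroid_connect; apply: connect1.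
by rewrite /e /edge -surjective_pairing pS.
Qed.

Lemma card_connect_gt0 i : 0 < #|connect e i|%:R :> R.
Proof. by rewrite ltr0n; apply/card_gt0P; exists i; exact: connect0. Qed.

Lemma centroid_radius X i D :
  (forall j, connect e i j -> enorm (ball_of X i - ball_of X j) <= D) ->
  enorm (ball_of (X - centroid X) i) <= D.
Proof.
move=> h; rewrite ball_ofB ball_conf; have c0 := card_connect_gt0 i.
have -> : ball_of X i - #|connect e i|%:R^-1 *: \sum_(j | connect e i j) ball_of X j =
    #|connect e i|%:R^-1 *: \sum_(j | connect e i j) (ball_of X i - ball_of X j).
  rewrite sumrB scalerBr; congr (_ - _).
  have -> : \sum_(j | connect e i j) ball_of X i = #|connect e i|%:R *: ball_of X i.
    by rewrite scaler_nat; exact: sumr_const.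
  by rewrite scalerA mulVf ?scale1r // gt_eqF.
rewrite enormZ ger0_norm ?invr_ge0 ?(ltW c0) // mulrC ler_pdivrMr // mulr_natr.
exact: enorm_sum.
Qed.

(** Test with the comoving vector that moves one component by the sum z of its balls. *)
Lemma centroid_orth Z : (forall u, comoving u -> dotp Z u = 0) -> centroid Z = 0.
Proof.
move=> h; apply: ball_eq => i; rewrite ball_conf ball_of0.
set z := \sum_(j | connect e i j) ball_of Z j.
suff -> : z = 0 by rewrite scaler0.
apply: dotp_eq0.
pose u : 'rV[R]_(n * d) := conf (fun j => if connect e i j then z else 0).
have uY : comoving u.
  move=> p pS; rewrite !ball_conf.
  have h1 : connect e p.1 p.2.
    by apply: connect1; rewrite /e /edge -surjective_pairing pS.
  by rewrite (same_connect_r (@edge_connect_sym _ S) h1).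
rewrite -(h u uY) dotp_ball {1}/z /dotp; under eq_bigr do rewrite summxE mulr_suml.
rewrite exchange_big /= [RHS](bigID (connect e i)) /= [X in _ = _ + X]big1 ?addr0.
  by apply: eq_bigr => j hj; apply: eq_bigr => k _; rewrite ball_conf hj /z summxE.
by move=> j hj; rewrite ball_conf (negbTE hj) big1 // => k _; rewrite [X in _ * X]mxE mulr0.
Qed.

Lemma contact_comoving r p X u : p \in S -> comoving u ->
  contact r p (X + u) <-> contact r p X.
Proof.
move=> pS hu; rewrite /contact /= !ball_ofD (hu _ pS).
by rewrite opprD addrACA subrr addr0.
Qed.

(** Conservation of momentum: obstacles are invariant under comoving translations, so the
    jumps are orthogonal to comoving vectors.  Hence the centroids move uniformly, and
    subtracting them leaves a path of constant speed; V is that speed. *)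
Lemma center_path (r : R) K tau (X W : nat -> 'rV[R]_(n * d)) lab : (1 < K)%N ->
  billiard (contact r) S K tau X W lab ->
  exists (V : R) W', billiard (contact r) S K (fun k => V * tau k)
    (fun k => X k - centroid (X k)) W' lab.
Proof.
move=> K1 hp.
have orth k u : (k.+1 < K)%N -> comoving u -> dotp (W k.+1 - W k) u = 0.
  move=> hk hu; have lS := bp_lab hp (ltnW hk); have hB := bp_hit hp (ltnW hk).
  have j1 := bp_jump hp hk ((contact_comoving r (X k.+1) lS hu).2 hB).
  have hu' : comoving (- u) by move=> p pS; rewrite -scaleN1r !ball_ofZ hu.
  have j2 := bp_jump hp hk ((contact_comoving r (X k.+1) lS hu').2 hB).
  rewrite (addrC (X k.+1)) addrK in j1; rewrite (addrC (X k.+1)) addrK dotpNr in j2.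
  by apply/eqP; rewrite eq_le j1 -oppr_le0 j2.
have cW k : (k.+1 < K)%N -> centroid (W k.+1) = centroid (W k).
  move=> hk; apply/subr0_eq; rewrite -centroidB; apply: centroid_orth => u hu.
  exact: orth.
pose w k := W k - centroid (W k).
have wE k : (k.+1 < K)%N -> w k.+1 - w k = W k.+1 - W k.
  by move=> hk; rewrite /w cW // opprB addrA subrK.
have wn k : (k < K)%N -> dotp (w k) (w k) = dotp (w 0%N) (w 0%N).
  elim: k => // k IH hk; rewrite -(IH (ltnW hk)).
  have e1 := orth k _ hk (centroid_comoving (W k)).
  have e2 := bp_unit hp hk; have e3 := bp_unit hp (ltnW hk).
  rewrite /w cW // !dotpE; rewrite dotpBl in e1.
  by rewrite e2 e3 !(dotpC (centroid (W k))); lra.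
pose V := enorm (w 0%N).
have V0 : 0 < V.
  rewrite lt_def enorm_ge0 andbT; apply/eqP => Vz.
  apply: (bp_turn hp K1); apply/subr0_eq; rewrite -wE // (enorm0_eq0 Vz) subr0.
  by apply: dotp_eq0; rewrite wn // (enorm0_eq0 Vz) dotp0l.
exists V, (fun k => V^-1 *: w k); split.
- exact: (bp_lab hp).
- move=> k hk; rewrite -scaleN1r -centroidZ.
  have hl := bp_lab hp hk.
  exact: ((contact_comoving r (X k) hl (centroid_comoving _)).2 (bp_hit hp hk)).
- by move=> k hk; rewrite ltr_pM2l // (bp_time hp).
- move=> k hk; rewrite -mulrBr scalerA mulrAC divff ?gt_eqF // mul1r.
  rewrite (bp_move hp hk) centroidD centroidZ /w scalerBr.
  by apply/rowP => i; rewrite !mxE; ring.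
- move=> k hk; rewrite dotpZl dotpZr wn // -enorm_sqr -/V.
  by field; rewrite gt_eqF.
- move=> k y hk hy; rewrite -scalerBr wE // dotpZl pmulr_rle0 ?invr_gt0 //.
  rewrite opprB addrA; apply: (bp_jump hp hk).
  have hl := bp_lab hp (ltnW hk).
  exact: ((contact_comoving r y hl (centroid_comoving _)).2 hy).
- move=> k hk h; apply: (bp_turn hp hk); apply/subr0_eq; rewrite -wE //.
  have : V^-1 *: (w k.+1 - w k) = 0 by rewrite scalerBr h subrr.
  by move/eqP; rewrite scaler_eq0 invr_eq0 (gt_eqF V0) /= => /eqP.
Qed.

Definition comps := #|[set fingraph.root e i | i : 'I_n]|.

End Centroid.

Section Global.
Context {R : realType} {n d : nat}.

(** The roots of the small graph are mapped onto those of the large one; between sets of the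
    same size this map is injective. *)
Lemma comps_sub (S' S : {set 'I_n * 'I_n}) : S' \subset S ->
  (comps S <= comps S')%N /\ ((comps S' <= comps S)%N ->
    forall i j, connect (edge S) i j -> connect (edge S') i j).
Proof.
move=> /fintype.subsetP sub.
have rel : subrel (connect (edge S')) (connect (edge S)).
  apply: connect_sub => i j /orP[] /sub h; apply: connect1; rewrite /edge h ?orbT //.
pose rt := fingraph.root (edge S); pose rt' := fingraph.root (edge S').
have rr i : rt (rt' i) = rt i.
  apply/esym/eqP; rewrite root_connect; last exact: edge_connect_sym.
  by apply: rel; exact: connect_root.
have eI : [set rt i | i : 'I_n] = rt @: [set rt' i | i : 'I_n].
  apply/setP => k; apply/imsetP/imsetP => [[i _ ->]|[_ /imsetP[i _ ->] ->]].
    by exists (rt' i); rewrite ?rr // imset_f.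
  by exists i.
split; first by rewrite /comps eI leq_imset_card.
move=> h i j; rewrite -root_connect; last exact: edge_connect_sym.
move=> /eqP hij; rewrite -root_connect; last exact: edge_connect_sym.
have /imset_injP inj : #|rt @: [set rt' i | i : 'I_n]| == #|[set rt' i | i : 'I_n]|.
  by rewrite eqn_leq leq_imset_card -eI.
by apply/eqP/inj; rewrite ?imset_f // !rr.
Qed.

Lemma comps_lt (S : {set 'I_n * 'I_n}) i j : (i, j) \in S -> i != j ->
  (comps S < n)%N.
Proof.
move=> h ne; rewrite ltn_neqAle; apply/andP; split; last first.
  by rewrite -[X in (_ <= X)%N](card_ord n); exact: max_card.
apply/eqP => hc.
have /imset_injP inj : #|[set fingraph.root (edge S) i | i : 'I_n]| == #|'I_n|.
  by rewrite [X in _ == X]card_ord; apply/eqP.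
move/eqP: ne; apply; apply: inj => //; apply/eqP.
rewrite root_connect; last exact: edge_connect_sym.
by apply: connect1; rewrite /edge h.
Qed.

End Global.

(** * The global bound for consecutive collisions *)

Definition labels (I : finType) (lab : nat -> I) (i l : nat) : {set I} :=
  [set lab (i + k)%N | k : 'I_l.+1].

Lemma labels_mem (I : finType) (lab : nat -> I) i l k : (k <= l)%N ->
  lab (i + k)%N \in labels lab i l.
Proof. by move=> h; apply/imsetP; exists (Ordinal (h : (k < l.+1)%N)). Qed.

Lemma labels_sub (R : realType) (m : nat) (I : finType)
    (B : I -> set 'rV[R]_m) (S : {set I}) K tau X W lab i l :
  billiard B S K tau X W lab -> (i + l <= K)%N -> labels lab i l \subset S.
Proof.
move=> hp h; apply/fintype.subsetP => _ /imsetP[k _ ->]; apply: (bp_lab hp).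
by apply: leq_trans h; rewrite leq_add2l -ltnS.
Qed.

Section Global.
Context {R : realType} {n d : nat}.
Hypothesis n3 : (3 <= n)%N.
Hypothesis d0 : (0 < d)%N.
Context {r : R}.
Hypothesis r0 : 0 < r.
Context {c : nat}.
Hypothesis hc : 1456 * @regularity R n + 10 < c%:R.

Let L := (c ^ (n * 5 ^ d)./2)%N.
Let D := (75 * n ^ 2)%N.

Lemma regularity_ge1 : 1 <= @regularity R n.
Proof.
have n1 : 1 <= n%:R :> R by rewrite ler1n; apply: leq_trans n3.
have s1 : 1 <= Num.sqrt n%:R :> R by rewrite -[X in X <= _]sqrtr1 ler_sqrt // (le_trans ler01).
rewrite /regularity; apply: (@le_trans _ _ (2 * 1 * 1)); first by lra.
by apply: ler_pM => //; lra.
Qed.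

Lemma c_gt0 : (0 < c)%N.
Proof. by rewrite -(ltr_nat R); apply: lt_trans hc; have := regularity_ge1; lra. Qed.

Lemma L_gt0 : (0 < L)%N.
Proof. by rewrite expn_gt0 c_gt0. Qed.

Definition hard_core (K : nat) (X : nat -> 'rV[R]_(n * d)) : Prop :=
  forall k i j, (k <= K)%N -> i != j -> 2 * r <= enorm (ball_of (X k) i - ball_of (X k) j).

(** While the configuration moves by r, only pairs at distance at most 4 r can collide. *)
Lemma window_count (S : {set 'I_n * 'I_n}) K tau X W lab tau' X' W' :
  (forall p, p \in S -> (p.1 < p.2)%N) ->
  billiard (contact r) S K tau X W lab -> hard_core K X ->
  billiard (contact r) S K tau' X' W' lab ->
  (forall k p, p \in S ->
    ball_of (X' k) p.1 - ball_of (X' k) p.2 = ball_of (X k) p.1 - ball_of (X k) p.2) ->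
  forall i j, (i <= j <= K)%N -> tau' j - tau' i <= r -> (j - i < L)%N.
Proof.
move=> ord hp hard hp' hX i j /andP[ij jK] ht.
have e : (i + (j - i) = j)%N by rewrite subnKC.
pose S' := labels lab i (j - i).
have subS : S' \subset S by apply: (labels_sub hp); rewrite e.
have memS p : p \in S' -> p \in S by move: p; apply/fintype.subsetP.
have hw : billiard (contact r) S' (j - i) (fun k => tau' (i + k)%N)
    (fun k => X' (i + k)%N) (fun k => W' (i + k)%N) (fun k => lab (i + k)%N).
  by apply: (billiard_sub hp'); [rewrite e|move=> k; exact: labels_mem].
have cnt := local_count (@contact_convex R n d r) regularity_ge1 hc
  (fun S' _ => ex_intro _ 0 (contact_core0 (ltW r0)))
  (fun S' _ x e e0 h => contact_retract r0 e0 h) hw.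
have near : (2 * #|S'| <= n * 5 ^ d)%N.
  apply: (near_pairs d0 (X := X i) r0).
  - by move=> a b; apply: hard; exact: leq_trans jK.
  - by move=> p /memS; exact: ord.
  - move=> p pS; rewrite -hX; last exact: memS.
    have /imsetP[k _ ep] := pS.
    have kj : (i + k <= j)%N by have := ltn_ord k; nlia.
    have hk : (i <= i + k <= K)%N by rewrite leq_addr (leq_trans kj).
    have hB := bp_hit hp' (k := (i + k)%N) ltac:(by case/andP: hk).
    rewrite -ep /contact /= in hB.
    have hl := X_lip hp' hk.
    have ht' := tau_mono hp' (i := (i + k)%N) (j := j) ltac:(by rewrite kj).
    have h1 := enorm_ball (X' i - X' (i + k)%N) p.1.
    have h2 := enorm_ball (X' i - X' (i + k)%N) p.2.
    rewrite enormB in hl.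
    have -> : ball_of (X' i) p.1 - ball_of (X' i) p.2 =
        (ball_of (X' (i + k)%N) p.1 - ball_of (X' (i + k)%N) p.2) +
        (ball_of (X' i - X' (i + k)%N) p.1 - ball_of (X' i - X' (i + k)%N) p.2).
      by rewrite !ball_ofB; apply/rowP => l; rewrite !mxE; ring.
    have h3 := enormD (ball_of (X' (i + k)%N) p.1 - ball_of (X' (i + k)%N) p.2)
      (ball_of (X' i - X' (i + k)%N) p.1 - ball_of (X' i - X' (i + k)%N) p.2).
    have h4 := enormD (ball_of (X' i - X' (i + k)%N) p.1)
      (- ball_of (X' i - X' (i + k)%N) p.2).
    rewrite enormN in h4; lra.
apply: ltn_trans (ltnSn _) _; apply: (leq_trans cnt).
apply: leq_pexp2l; first exact: c_gt0.
by rewrite -(doubleK #|S'|) half_leq // -mul2n.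
Qed.

(** In the frame of the centroids, a configuration whose contacts hold along a graph with the
    given components has size at most 2 n^2 r; twice as far away, the contacts must be
    violated in proportion to the distance from the origin. *)
Lemma spread (S S' : {set 'I_n * 'I_n}) (X : 'rV[R]_(n * d)) e : 0 <= e ->
  (forall i j, connect (edge S) i j -> connect (edge S') i j) ->
  bodies_within (contact r) S' (X - centroid S X) e ->
  4 * n%:R ^+ 2 * r < enorm (X - centroid S X - 0) ->
  enorm (X - centroid S X - 0) <= 4 * n%:R ^+ 2 * e.
Proof.
move=> e0 hcon hw; rewrite subr0; set Y := X - centroid S X in hw *.
have D0 : 0 <= 2 * r + 2 * e by have := r0; lra.
have n1 : 1 <= n%:R :> R by rewrite ler1n; apply: leq_trans n3.
have n0 : 0 <= n%:R :> R by apply: le_trans n1.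
have hb i : enorm (ball_of Y i) <= n%:R * (2 * r + 2 * e).
  apply: centroid_radius => j hij.
  have -> : ball_of X i - ball_of X j = ball_of Y i - ball_of Y j.
    by rewrite !ball_ofB (centroid_connect X hij) opprB addrA subrK.
  apply: (enorm_connect D0 _ (hcon _ _ hij)) => p pS.
  exact: within_contact hw pS.
have h := enorm_balls (mulr_ge0 n0 D0) hb.
have sn : Num.sqrt n%:R <= n%:R :> R.
  rewrite -[X in _ <= X](ger0_norm n0) -sqrtr_sqr ler_sqrt ?exprn_ge0 //.
  by rewrite expr2 ler_peMl.
have h2 : enorm Y <= n%:R ^+ 2 * (2 * r + 2 * e).
  apply: (le_trans h); rewrite mulrA expr2; apply: ler_wpM2r => //.
  exact: ler_wpM2r.
by move=> hfar; lra.
Qed.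

(** The induction is on the rank.  A stretch of q collisions has as many components as the
    whole run, since otherwise its rank would be smaller and it would be shorter than q. *)
Lemma global_count rho (S : {set 'I_n * 'I_n}) K tau X W lab :
  (forall p, p \in S -> (p.1 < p.2)%N) ->
  billiard (contact r) S K tau X W lab -> hard_core K X ->
  (n <= comps S + rho)%N -> (K.+1 < D ^ rho * L)%N.
Proof.
elim: rho S K tau X W lab => [|rho IH] S K tau X W lab ord hp hard hrho.
  have hl := bp_lab hp (leq0n K).
  have ne : (lab 0%N).1 != (lab 0%N).2.
    by apply/eqP => e; have := ord _ hl; rewrite e ltnn.
  have := @comps_lt n S (lab 0%N).1 (lab 0%N).2; rewrite -surjective_pairing.
  by move=> /(_ hl ne); rewrite addn0 in hrho; rewrite ltnNge hrho.
rewrite ltnNge; apply/negP => hK.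
set q := (D ^ rho * L)%N.
have D0 : (0 < D)%N by rewrite muln_gt0 expn_gt0 /=; apply/orP; left; apply: leq_trans n3.
have Lq : (L <= q)%N by rewrite leq_pmull // expn_gt0 D0.
have q0 : (0 < q)%N := leq_trans L_gt0 Lq.
have hN : (D.-1 * q <= K)%N.
  by rewrite expnS -mulnA -/q in hK; rewrite -subn1 mulnBl mul1n; nlia.
have n2 : (0 < n ^ 2)%N by rewrite expn_gt0 (leq_trans _ n3).
have D3 : (3 < D)%N by rewrite /D; nlia.
have K1 : (1 < D.-1 * q)%N.
  by apply: (@leq_trans (D.-1 * 1)); [rewrite muln1; nlia|rewrite leq_mul2l q0 orbT].
have hp1 := billiard_prefix hp hN.
have hard1 : hard_core (D.-1 * q) X by move=> k i j hk; apply: hard; apply: leq_trans hN.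
pose Sg j := labels lab (j * q) q.
have jqN j : (j < D.-1)%N -> (j * q + q <= D.-1 * q)%N.
  by move=> hj; rewrite addnC -mulSn leq_pmul2r.
have hh j : (j < D.-1)%N -> hits (Sg j) lab (j * q) (j.+1 * q).
  move=> hj _ /imsetP[k _ ->]; exists (j * q + k)%N => //.
  by rewrite leq_addr /= mulSn [(q + _)%N]addnC leq_add2l -ltnS ltn_ord.
have hcon j : (j < D.-1)%N ->
    forall a b, connect (edge S) a b -> connect (edge (Sg j)) a b.
  move=> hj; have sub : Sg j \subset S by apply: (labels_sub hp1); exact: jqN.
  have [_ h] := comps_sub sub; apply: h.
  rewrite leqNgt; apply/negP => hlt.
  have hp2 : billiard (contact r) (Sg j) q (fun k => tau (j * q + k)%N)
      (fun k => X (j * q + k)%N) (fun k => W (j * q + k)%N)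
      (fun k => lab (j * q + k)%N).
    by apply: (billiard_sub hp1 (jqN j hj)) => k; exact: labels_mem.
  have := IH (Sg j) q _ _ _ _ _ hp2; rewrite -/q ltnNge leqnSn; move=> h2.
  suff : false by [].
  apply: h2.
  - by move=> p /(fintype.subsetP sub); exact: ord.
  - move=> k a b hk; apply: hard1; apply: leq_trans (jqN j hj).
    by rewrite leq_add2l.
  - by nlia.
have [V [W' hp']] := center_path K1 hp1.
pose X' k := X k - centroid S (X k).
have hdiff k p : p \in S ->
    ball_of (X' k) p.1 - ball_of (X' k) p.2 = ball_of (X k) p.1 - ball_of (X k) p.2.
  move=> pS; rewrite !ball_ofB (centroid_comoving (X k) pS).
  by rewrite opprB addrA subrK.
have hwin := window_count ord hp1 hard1 hp' hdiff.
have n3R : 3 <= n%:R :> R by rewrite (ler_nat R 3 n).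
have n9 : 9 <= n%:R ^+ 2 :> R by rewrite expr2; nra.
have A1 : 1 <= 4 * n%:R ^+ 2 :> R by lra.
have H0 : 0 < 4 * n%:R ^+ 2 * r by rewrite mulr_gt0 //; lra.
have hZ : 2 * (4 * n%:R ^+ 2 * r) < ((8 * n ^ 2).+1)%:R * r.
  by rewrite -[(8 * n ^ 2).+1%:R]natr1 natrM natrX; have : 0 < r by []; lra.
have hf j i e : (j < D.-1)%N -> (j <= i <= j.+1)%N -> 0 <= e ->
    bodies_within (contact r) (Sg j) (X' (i * q)%N) e ->
    4 * n%:R ^+ 2 * r < enorm (X' (i * q)%N - 0) ->
    enorm (X' (i * q)%N - 0) <= 4 * n%:R ^+ 2 * e.
  by move=> hj _ e0; apply: spread => //; exact: hcon.
have := apex_total (@contact_convex R n d r) A1 (contact_core0 (ltW r0)) q0 Lq hp'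
  hh H0 r0 hf hwin hZ.
have -> : D.-1%:R = 75 * n%:R ^+ 2 - 1 :> R.
  by rewrite -subn1 natrB // /D natrM natrX.
rewrite -[(8 * n ^ 2).+1%:R]natr1 natrM natrX; lra.
Qed.

End Global.

(** * From the motion of the balls to a billiard path *)

Import numFieldNormedType.Exports.
Local Open Scope classical_set_scope.
Local Open Scope ring_scope.

Section Bridge.
Context {R : realType} {d n : nat} {r : R} {x v : 'I_n -> R -> 'rV[R]_d}.
Hypothesis r0 : 0 < r.
Hypothesis hxv : hard_ball_motion r x v.
Hypothesis hsim : no_simultaneous_collisions r x v.

Local Notation CT := (collision_times r x v).
Local Notation quiet a b := (forall t, a < t < b -> ~ CT t).

Lemma quiet_limR k a b s : quiet a b -> a < s < b -> v k s = limR (v k) a.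
Proof.
move=> q hs; apply/esym; apply: norm_lim_near_cst.
have ab : a < b by case/andP: hs => h1 h2; apply: lt_trans h1 h2.
near=> u; apply: (hbm_constant hxv k q) => //.
by apply/andP; split; near: u; [exact: nbhs_right_gt|exact: nbhs_right_lt].
Unshelve. all: by end_near. Qed.

Lemma quiet_limL k a b s : quiet a b -> a < s < b -> v k s = limL (v k) b.
Proof.
move=> q hs; apply/esym; apply: norm_lim_near_cst.
have ab : a < b by case/andP: hs => h1 h2; apply: lt_trans h1 h2.
near=> u; apply: (hbm_constant hxv k q) => //.
by apply/andP; split; near: u; [exact: nbhs_left_gt|exact: nbhs_left_lt].
Unshelve. all: by end_near. Qed.

Lemma quiet_velocity k a b : a < b -> quiet a b -> limR (v k) a = limL (v k) b.
Proof.
move=> ab q; have h : a < (a + b) / 2 < b by apply/andP; split; lra.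
by rewrite -(quiet_limR k q h) (quiet_limL k q h).
Qed.

Lemma quiet_flight k a b : a < b -> quiet a b ->
  x k b = x k a + (b - a) *: limR (v k) a.
Proof.
move=> ab q; apply/rowP => c; rewrite !mxE.
have der t : t \in `]a, b[%R ->
    is_derive t (1 : R) (fun s => x k s ord0 c) (limR (v k) a ord0 c).
  rewrite in_itv /= => ht; have [h1 h2] := hbm_derive hxv k (q t ht).
  apply: DeriveDef; first exact: ((derivable_mxP _ _ _).1 h1 ord0 c).
  have := derive_mx h1; rewrite h2 (quiet_limR k q ht) => /(congr1 (fun M : 'rV[R]_d => M ord0 c)).
  by rewrite mxE => ->.
have cont : {within `[a, b], continuous (fun s => x k s ord0 c)}.
  apply: continuous_subspaceT => t.
  apply: (@continuous_comp _ _ _ (x k) (fun M : 'rV[R]_d => M ord0 c)).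
    by have := @hbm_continuous _ _ _ _ _ _ hxv k t.
  exact: coord_continuous.
have [u _] := MVT ab der cont.
by move=> /eqP; rewrite subr_eq addrC mulrC => /eqP.
Qed.

Lemma collide_sym j k t : collide r x v j k t -> collide r x v k j t.
Proof. by case=> h1 h2 h3 h4; split; rewrite 1?eq_sym // enormB. Qed.

Lemma finite_collision_times a b : finite_set (CT `&` `[a, b]).
Proof.
apply: contrapT => inf.
have bd : bounded_set (CT `&` `[a, b]).
  have bs := compact_bounded (@segment_compact R a b).
  apply: (sub_boundedr _ bs) => U hU t [_ ht]; exact: hU.
have [t ht] := infinite_bounded_limit_point_nonempty inf bd.
have : limit_point CT t.
  by move=> U /ht[y [h1 [h2 _] h3]]; exists y.
by rewrite (hbm_discrete hxv).
Qed.

Definition impulse (p : 'I_n * 'I_n) (w : 'rV[R]_d) : 'rV[R]_(n * d) :=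
  conf (fun i => if i == p.1 then w else if i == p.2 then - w else 0).

Lemma dotp_impulse p w Y : p.1 != p.2 ->
  dotp (impulse p w) Y = dotp w (ball_of Y p.1 - ball_of Y p.2).
Proof.
move=> ne; rewrite dotp_ball (bigD1 p.1) //= (bigD1 p.2) /=; last by rewrite eq_sym.
rewrite big1 ?addr0 => [|i /andP[/negbTE h1 /negbTE h2]]; last first.
  by rewrite ball_conf h1 h2 dotp0l.
by rewrite !ball_conf eqxx eq_sym (negbTE ne) eqxx dotpBr dotpNl.
Qed.

Definition positions t : 'rV[R]_(n * d) := conf (x ^~ t).
Definition velL t : 'rV[R]_(n * d) := conf (fun i => limL (v i) t).
Definition velR t : 'rV[R]_(n * d) := conf (fun i => limR (v i) t).

Lemma collision_jump j k t : collide r x v j k t ->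
  exists2 s : R, 0 < s & let e := direction x j k t in
   [/\ velR t - velL t = impulse (j, k) (s *: e),
      s = - dotp e (limL (v j) t - limL (v k) t),
      dotp e e = 1 & dotp e (x j t - x k t) = 2 * r].
Proof.
move=> hc; have [ne hd hj hk] := hc; have [h1 h2 h3] := hbm_elastic hxv hc.
set e := direction x j k t in h1 h2 h3 *; rewrite dotpC in h1.
have eE : e = (2 * r)^-1 *: (x j t - x k t) by rewrite /e /direction hd.
have r2 : 0 < 2 * r by rewrite mulr_gt0.
have dD : dotp (x j t - x k t) (x j t - x k t) = (2 * r) ^+ 2.
  by rewrite -enorm_sqr hd.
exists (- dotp e (limL (v j) t - limL (v k) t)).
  by rewrite eE dotpZl oppr_gt0 pmulr_rlt0 ?invr_gt0.
split => //.
- apply: ball_eq => i; rewrite ball_ofB !ball_conf /=.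
  have [->|nj] := eqVneq i j.
    rewrite h2 !(dotpC _ e) dotpBr.
    by apply/rowP => l; rewrite !mxE; ring.
  have [->|nk] := eqVneq i k.
    rewrite h3 !(dotpC _ e) dotpBr.
    by apply/rowP => l; rewrite !mxE; ring.
  rewrite (hbm_unchanged hxv (k := i) (t := t)) ?subrr // => -[l hl].
  have := hsim hl hc => /setP/(_ i); rewrite !inE eqxx orbT.
  by rewrite (negbTE nj) (negbTE nk).
- by rewrite eE !dotpZl !dotpZr dD; field; rewrite !gt_eqF.
- by rewrite eE dotpZl dD; field; rewrite !gt_eqF.
Qed.

Lemma collision_energy j k t : collide r x v j k t ->
  dotp (velR t) (velR t) = dotp (velL t) (velL t).
Proof.
move=> hc; have ne : j != k by case: hc.
have [s s0 [hJ hs he _]] := collision_jump hc.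
set J := impulse _ _ in hJ; set e := direction x j k t in J hJ hs he.
have -> : velR t = velL t + J by rewrite -hJ addrC subrK.
have h1 : dotp J (velL t) = - s ^+ 2.
  by rewrite dotp_impulse // !ball_conf dotpZl hs; ring.
have h2 : dotp J J = 2 * s ^+ 2.
  rewrite dotp_impulse // !ball_conf eqxx [_ == j]eq_sym (negbTE ne) eqxx.
  by rewrite opprK dotpZl dotpDr (dotpZr s) he; ring.
by rewrite dotpDl !dotpDr (dotpC (velL t) J) h1 h2; ring.
Qed.

Lemma collision_normal j k t y : collide r x v j k t -> contact r (j, k) y ->
  dotp (velR t - velL t) (y - positions t) <= 0.
Proof.
move=> hc hy; have ne : j != k by case: hc.
have [s s0 [hJ _ he hD]] := collision_jump hc.
rewrite hJ dotp_impulse //= dotpZl pmulr_rle0 // !ball_ofB !ball_conf.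
rewrite /contact /= in hy.
have -> : ball_of y j - x j t - (ball_of y k - x k t) =
  (ball_of y j - ball_of y k) - (x j t - x k t).
  by apply/rowP => l; rewrite !mxE; ring.
rewrite dotpBr hD subr_le0; apply: le_trans (cauchy_schwarz _ _) _.
by rewrite {1}/enorm he sqrtr1 mul1r.
Qed.

Lemma collision_turn j k t : collide r x v j k t -> velR t <> velL t.
Proof.
case=> _ _ h _ e; apply: h; have := congr1 (fun Y => ball_of Y j) e.
by rewrite !ball_conf.
Qed.

End Bridge.

(** * The number of collisions *)

Section Bound.
Context (R : realType) (d n : nat).
Hypothesis n3 : (3 <= n)%N.

(** The number c of local_count; its power n 5^d / 2 is (32 n^(3/2)) to the power n 5^d. *)
Definition pair_factor := (1024 * n ^ 3)%N.
(** The factor 75 n^2, one per step of the rank, exceeds the number of stretches that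
    apex_total allows for A = 4 n^2 and Z = 8 n^2 + 1. *)
Definition collision_bound := ((75 * n ^ 2) ^ n * pair_factor ^ (n * 5 ^ d)./2)%N.

Lemma pair_factor_large : 1456 * @regularity R n + 10 < pair_factor%:R.
Proof.
rewrite /regularity /pair_factor natrM natrX; set s := Num.sqrt _.
have n3R : 3 <= n%:R :> R by rewrite (ler_nat R 3 n).
have s2 : s ^+ 2 = n%:R by rewrite sqr_sqrtr // ler0n.
have s0 : 0 <= s by exact: sqrtr_ge0.
rewrite -s2 in n3R *; set z := s ^+ 3.
have zE : s ^+ 2 * s = z by rewrite /z -exprSr.
have z2 : (s ^+ 2) ^+ 3 = z ^+ 2 by rewrite /z -!exprM.
have z5 : 5 <= z.
  rewrite -(@ler_pXn2r _ 2) ?nnegrE ?exprn_ge0 // -z2.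
  apply: (@le_trans _ _ (3 ^+ 3)); first by rewrite -!natrX ler_nat.
  by rewrite ler_pXn2r // nnegrE // exprn_ge0.
rewrite z2; have -> : 1456 * (2 * s ^+ 2 * s) = 2912 * z by rewrite -zE; ring.
have : 5 * z <= z ^+ 2 by rewrite expr2 ler_wpM2r //; lra.
lra.
Qed.

Lemma collision_bound_large : (2 < collision_bound)%N.
Proof.
have n0 : (0 < n)%N by apply: leq_trans n3.
have c0 : (0 < pair_factor ^ (n * 5 ^ d)./2)%N.
  by rewrite expn_gt0 /pair_factor muln_gt0 expn_gt0 n0.
have n2 : (0 < n ^ 2)%N by rewrite expn_gt0 n0.
apply: (@leq_trans ((75 * n ^ 2) ^ n)); last by rewrite leq_pmulr.
apply: (@leq_trans ((75 * n ^ 2) ^ 1)); last by apply: leq_pexp2l => //; lia.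
by rewrite expn1; lia.
Qed.

Lemma collision_bound_le : collision_bound%:R <=
  1600 * (1000 * 32 ^+ (5 ^ d)%N) ^+ n
      * n%:R `^ ((3 / 2 * 5 ^+ d + 9 / 2) * n%:R + 3 / 2) :> R.
Proof.
rewrite /collision_bound /pair_factor; set h := (n * 5 ^ d)./2.
have hh : (2 * h <= n * 5 ^ d)%N by rewrite mul2n -[X in (_ <= X)%N]odd_double_half leq_addl.
have n1 : 1 <= n%:R :> R by rewrite ler1n; apply: leq_trans n3.
have n0 : 0 <= n%:R :> R by apply: le_trans n1.
have -> : ((75 * n ^ 2) ^ n * (1024 * n ^ 3) ^ h = 75 ^ n * 32 ^ (2 * h) * n ^ (2 * n + 3 * h))%N.
  have e32 : (1024 ^ h = 32 ^ (2 * h))%N by rewrite expnM.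
  have en : (n ^ (2 * n + 3 * h) = n ^ n * n ^ n * (n ^ h * (n ^ h * n ^ h)))%N.
    by rewrite -!expnD; congr (n ^ _)%N; lia.
  by rewrite !expnMn e32 en; ring.
rewrite !natrM !natrX; apply: ler_pM; rewrite ?mulr_ge0 ?exprn_ge0 //.
  rewrite exprMn mulrA; apply: ler_pM; rewrite ?exprn_ge0 //.
    apply: (@le_trans _ _ (1 * 1000 ^+ n)).
      by rewrite mul1r; apply: lerXn2r; rewrite ?nnegrE ?ler0n // ler_nat.
    by apply: ler_wpM2r; rewrite ?exprn_ge0 ?ler0n // ler1n.
  by rewrite -exprM [(5 ^ d * n)%N]mulnC; apply: ler_weXn2l; rewrite ?ler1n.
rewrite -powR_mulrn //; apply: ler_powR => //.
have : (2 * h)%:R <= (n * 5 ^ d)%:R :> R by rewrite ler_nat.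
rewrite natrD !natrM natrX; set y : R := 5 ^+ d * n%:R.
have -> : n%:R * 5 ^+ d = y by rewrite mulrC.
have -> : (3 / 2 * 5 ^+ d + 9 / 2) * n%:R + 3 / 2 = 3 / 2 * y + 9 / 2 * n%:R + 3 / 2 :> R.
  by rewrite /y; ring.
lra.
Qed.

End Bound.

Section Assemble.
Context {R : realType} {d n : nat} {r : R} {x v : 'I_n -> R -> 'rV[R]_d}.
Hypothesis d0 : (0 < d)%N.
Hypothesis n3 : (3 <= n)%N.
Hypothesis r0 : 0 < r.
Hypothesis hxv : hard_ball_motion r x v.
Hypothesis hsim : no_simultaneous_collisions r x v.

Local Notation CT := (collision_times r x v).

(** The speed of the configuration is constant, by conservation of energy, and positive
    because velocities change; rescaling time makes it 1. *)
Lemma consecutive_bound K (tau : nat -> R) :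
  (forall k, (k < K)%N -> tau k < tau k.+1) ->
  (forall k, (k <= K)%N -> CT (tau k)) ->
  (forall k, (k < K)%N -> forall t, tau k < t < tau k.+1 -> ~ CT t) ->
  (K.+1 < collision_bound d n)%N.
Proof.
move=> inc hit quiet.
case: (posnP K) => [->|K0]; first exact: ltn_trans (collision_bound_large d n3).
have hlab k : exists p : 'I_n * 'I_n, (k <= K)%N ->
    (p.1 < p.2)%N /\ collide r x v p.1 p.2 (tau k).
  have [hk|hk] := leqP k K; last first.
    by have [j [l _]] := hit 0%N (leq0n _); exists (j, l).
  have [j [l hc]] := hit k hk; have ne : j != l by case: hc.
  have [h|h] := ltnP j l; first by exists (j, l).
  exists (l, j) => _; split; last exact: collide_sym.
  by rewrite /= ltn_neqAle h andbT eq_sym.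
have [lab labP] := choice hlab.
have lc k : (k <= K)%N -> collide r x v (lab k).1 (lab k).2 (tau k).
  by move=> hk; case: (labP k hk).
have vLR k : (k < K)%N -> velL (v := v) (tau k.+1) = velR (v := v) (tau k).
  move=> hk; apply: ball_eq => i; rewrite !ball_conf.
  by rewrite -(quiet_velocity hxv i (inc k hk) (quiet k hk)).
have energy k : (k <= K)%N ->
    dotp (velR (v := v) (tau k)) (velR (v := v) (tau k)) =
    dotp (velR (v := v) (tau 0%N)) (velR (v := v) (tau 0%N)).
  elim: k => [//|k IH] hk; apply: etrans (IH (ltnW hk)).
  apply: etrans (collision_energy r0 hxv hsim (lc k.+1 hk)) _.
  exact: (congr1 (fun w : 'rV[R]_(n * d) => dotp w w) (vLR k hk)).
set V := enorm (velR (v := v) (tau 0%N)).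
have V2 k : (k <= K)%N -> dotp (velR (v := v) (tau k)) (velR (v := v) (tau k)) = V ^+ 2.
  by move=> hk; rewrite energy // enorm_sqr.
have V0 : 0 < V.
  rewrite lt_def enorm_ge0 andbT; apply/eqP => Vz.
  apply: (collision_turn (lc 1%N K0)); apply: etrans (esym (vLR 0%N K0)).
  rewrite (enorm0_eq0 Vz).
  by apply: dotp_eq0; rewrite V2 // Vz expr0n.
pose S : {set 'I_n * 'I_n} := [set p : 'I_n * 'I_n | (p.1 < p.2)%N]%SET.
have hp : billiard (contact r) S K (fun k => V * tau k) (fun k => positions (x := x) (tau k))
    (fun k => V^-1 *: velR (v := v) (tau k)) lab.
  split.
  - by move=> k hk; rewrite inE; case: (labP k hk).
  - move=> k hk; rewrite /contact /= !ball_conf.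
    by have [_ -> _ _] := lc k hk.
  - by move=> k hk; rewrite ltr_pM2l // inc.
  - move=> k hk; rewrite -mulrBr scalerA mulrAC divff ?gt_eqF // mul1r.
    apply: ball_eq => i; rewrite ball_ofD ball_ofZ !ball_conf.
    exact: (quiet_flight hxv i (inc k hk) (quiet k hk)).
  - move=> k hk; rewrite dotpZl dotpZr V2; last exact: ltnW.
    by field; rewrite gt_eqF.
  - move=> k y hk hy; rewrite -scalerBr dotpZl pmulr_rle0 ?invr_gt0 //.
    rewrite -(vLR k (ltnW hk)).
    apply: (collision_normal r0 hxv hsim (lc k.+1 (ltnW hk))).
    by rewrite -surjective_pairing.
  - move=> k hk e; apply: (collision_turn (lc k.+1 (ltnW hk))).
    rewrite (vLR k (ltnW hk)).
    by apply: (scalerI _ e); rewrite invr_eq0 gt_eqF.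
apply: (global_count n3 d0 r0 (pair_factor_large R n3) (rho := n) _ hp).
- by move=> p; rewrite inE.
- by move=> k i j hk ne; rewrite !ball_conf; apply: (hbm_hard hxv).
- exact: leq_addl.
Qed.

(** Finitely many collision times lie among the consecutive collision times of a bounded
    interval. *)
Lemma times_bound (s : seq R) : uniq s -> (forall t, t \in s -> CT t) ->
  (size s < collision_bound d n)%N.
Proof.
move=> us hs.
pose b := \sum_(t <- s) `|t|.
pose A := CT `&` `[- b, b].
have finA : finite_set A by exact: finite_collision_times.
pose ts := sort <=%R (fset_set A).
have memA t : (t \in ts) = (t \in A) by rewrite mem_sort in_fset_set.
have uts : uniq ts by rewrite sort_uniq fset_uniq.
have sub : {subset s <= ts}.
  move=> t ht; rewrite memA inE; split; first exact: hs.
  rewrite /= in_itv /= -ler_norml /b (bigD1_seq t) //= lerDl.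
  by apply: sumr_ge0 => u _; exact: normr_ge0.
apply: leq_ltn_trans (uniq_leq_size us sub) _.
have srt : sorted <%R ts by rewrite lt_sorted_uniq_le uts sort_le_sorted.
case e: (size ts) => [|K]; first by apply: ltn_trans (collision_bound_large d n3).
have CTk k : (k <= K)%N -> A (nth 0 ts k).
  move=> hk; have : nth 0 ts k \in ts by rewrite mem_nth // e.
  by rewrite memA inE.
apply: (consecutive_bound (tau := nth 0 ts)).
- by move=> k hk; rewrite (lt_sorted_ltn_nth 0 srt) ?inE ?e //; lia.
- by move=> k /CTk[].
- move=> k hk t /andP[h1 h2] ht.
  have tA : t \in ts.
    rewrite memA inE; split => //=; rewrite in_itv /=.
    have [_ /=] := CTk k (ltnW hk); have [_ /=] := CTk k.+1 hk.
    rewrite !in_itv /= => /andP[_ h3] /andP[h4 _].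
    by rewrite (le_trans h4 (ltW h1)) (le_trans (ltW h2) h3).
  have := nth_index 0 tA; have := tA; rewrite -index_mem e => hi ei.
  rewrite -ei in h1 h2.
  rewrite (lt_sorted_ltn_nth 0 srt) ?inE ?e // in h1; last by lia.
  rewrite (lt_sorted_ltn_nth 0 srt) ?inE ?e // in h2; lia.
Qed.

(** Without simultaneous collisions the time determines the pair. *)
Lemma collisions_seq_bound (s : seq (R * {set 'I_n})) : uniq s ->
  (forall p, p \in s -> collisions r x v p) -> (size s < collision_bound d n)%N.
Proof.
move=> us hs; rewrite -(size_map fst); apply: times_bound.
  rewrite map_inj_in_uniq // => -[t p] [t' p'] /= h h' e; rewrite -e in h' *.
  have [j [k [/= c1 ->]]] := hs _ h; have [j' [k' [/= c2 ->]]] := hs _ h'.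
  by rewrite (hsim c1 c2).
move=> _ /mapP[p /hs[j [k [h _]]] ->]; by exists j, k.
Qed.

Lemma collisions_finite : finite_set (collisions r x v).
Proof.
apply: contrapT => inf; have [F hF hc] := infinite_set_fset (collision_bound d n) inf.
have := collisions_seq_bound (fset_uniq F) (fun p hp => hF p hp).
by rewrite ltnNge hc.
Qed.

Lemma collisions_card : (#|` fset_set (collisions r x v)|%fset < collision_bound d n)%N.
Proof.
apply: collisions_seq_bound; first exact: fset_uniq.
move=> p; rewrite in_fset_set ?inE //; exact: collisions_finite.
Qed.

End Assemble.

Theorem theorem1p1 (R : realType) (d n : nat) (hd : (2 <= d)%N) (hn : (3 <= n)%N)
    (r : R) (hr : 0 < r) (x v : 'I_n -> R -> 'rV[R]_d)
    (hxv : hard_ball_motion r x v)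
    (hsim : no_simultaneous_collisions r x v) :
  finite_set (collisions r x v) /\
  (#|` fset_set (collisions r x v)|%fset)%:R <=
    1600 * (1000 * 32 ^+ (5 ^ d)%N) ^+ n
      * n%:R `^ ((3 / 2 * 5 ^+ d + 9 / 2) * n%:R + 3 / 2) :> R.
Proof.
have d0 : (0 < d)%N by apply: ltn_trans hd.
split; first exact: (collisions_finite d0 hn hr hxv hsim).
apply: le_trans (collision_bound_le R d hn).
by rewrite ler_nat ltnW // (collisions_card d0 hn hr hxv hsim).
Qed.
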